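(* Fix $\theta$ and suppose: (i) $F:\mathbb{R}^{SA}\to\mathbb{R}$ is concave and differentiable on all of $\mathbb{R}^{SA}$, and there is $\ell_F$ with $\max\{\|\nabla F(\lambda)\|_\infty:\|\lambda\|_1\le\frac{2}{1-\gamma}\}\le\ell_F$; (ii) $F$ is $L_F$-smooth with respect to the $\ell_1$ norm: $\|\nabla F(\lambda)-\nabla F(\lambda')\|_\infty\le L_F\|\lambda-\lambda'\|_1$ for all $\lambda,\lambda'$; (iii) $F^*$ is $\ell_{F^*}$-Lipschitz with respect to $\|\cdot\|_\infty$ on $\{z:\|z\|_\infty\le2\ell_F,\ F^*(z)>-\infty\}$; (iv) $\pi_\theta$ is differentiable in $\theta$ and there is $C$ with $\|\nabla_\theta\pi_\theta(\cdot|s)\|_{\infty,2}\le C$ for all $s$, where $\nabla_\theta\pi_\theta(\cdot|s)=[\nabla_\theta\pi_\theta(1|s),\dots,\nabla_\theta\pi_\theta(A|s)]\in\mathbb{R}^{d\times A}$. Given $n$ i.i.d. episodes of length $K$ generated by $\pi_\theta$, define for $\delta>0$ $$\hat\nabla_\theta R(\pi_\theta;\delta):=\operatorname*{argmax}_{x\in\mathbb{R}^d}\ \inf_{\|z\|_\infty\le\ell_F}\Big\{-F^*(z)+\tilde V(\theta;z)+\delta\,\nabla_\theta\tilde V(\theta;z)^\top x-\tfrac{\delta}{2}\|x\|^2\Big\}$$ and $\hat\nabla_\theta R(\pi_\theta):=\lim_{\delta\to0_+}\hat\nabla_\theta R(\pi_\theta;\delta)$. Then $$\mathbb E\big[\|\hat\nabla_\theta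 R(\pi_\theta)-\nabla_\theta R(\pi_\theta)\|^2\big]\le\mathcal O\Big(\frac{C^2(\ell_F^2+L_F^2\ell_{F^*}^2)}{n(1-\gamma)^4}+\frac{C^2L_F^2}{n(1-\gamma)^6}\Big)+\mathcal O(\gamma^K),$$ where the first $\mathcal O$ hides only a numerical constant and the second a constant independent of $n$ and $K$.
   Context: Finite MDP with states $\mathcal S$ ($S=|\mathcal S|$), actions $\mathcal A$ ($A=|\mathcal A|$), transitions $P_a(i,j)$, initial distribution $\xi$, discount $\gamma\in(0,1)$. Policies $\pi_\theta$, $\theta\in\Theta\subset\mathbb{R}^d$; occupancy measure $\lambda(\theta)_{sa}=\sum_{t\ge0}\gamma^t\mathbb P(s_t=s,a_t=a\mid\pi_\theta,s_0\sim\xi)$; objective $R(\pi_\theta)=F(\lambda(\theta))$; Fenchel dual $F^*(z)=\inf_\lambda\{\langle\lambda,z\rangle-F(\lambda)\}$. For $z\in\mathbb{R}^{SA}$, $Q^{\pi}(s,a;z):=\mathbb E^\pi[\sum_t\gamma^tz_{s_ta_t}\mid s_0=s,a_0=a]$ (assumed known exactly). Episodes $\zeta_i=\{(s^{(i)}_k,a^{(i)}_k)\}_{k=0}^K$, $i=1,\dots,n$, are i.i.d. trajectories of $\pi_\theta$ started from $s_0\sim\xi$. Estimators: $\tilde V(\theta;z):=\frac1n\sum_{i=1}^n\sum_{k=0}^K\gamma^k z(s^{(i)}_k,a^{(i)}_k)$ and $\nabla_\theta\tilde V(\theta;z):=\frac1n\sum_{i=1}^n\sum_{k=0}^K\sum_{a\in\mathcal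 A}\gamma^kQ^{\pi_\theta}(s^{(i)}_k,a;z)\nabla_\theta\pi_\theta(a|s^{(i)}_k)$. For a matrix $B$, $\|B\|_{\infty,2}:=\max_{\|u\|_\infty\le1}\|Bu\|_2$. *)

(* Defs.v *)
From mathcomp Require Import all_boot all_order all_algebra.
From mathcomp Require Import all_classical all_reals all_analysis.
Set Implicit Arguments. Unset Strict Implicit. Unset Printing Implicit Defensive.
Import Order.TTheory GRing.Theory Num.Theory.
Import numFieldNormedType.Exports.
Local Open Scope classical_set_scope.
Local Open Scope ring_scope.

(* States are 'I_S, actions are 'I_A.  Vectors indexed by state-action pairs
   (occupancy measures lambda, reward-like vectors z) are 'M[R]_(S,A).
   Parameters theta live in 'rV[R]_d.  A policy is p : 'M[R]_(S,A) with
   p s a = pi(a|s); a parametric policy is pi : 'rV[R]_d -> 'M[R]_(S,A).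
   Transitions: P a : 'M[R]_S with P a i j = P_a(i,j).  xi : 'rV[R]_S. *)

Definition ninf (R : realType) m n (M : 'M[R]_(m, n)) : R :=
  \big[Num.max/0]_(i < m) \big[Num.max/0]_(j < n) `|M i j|.
Definition n1 (R : realType) m n (M : 'M[R]_(m, n)) : R :=
  \sum_(i < m) \sum_(j < n) `|M i j|.
Definition sqn2 (R : realType) m n (M : 'M[R]_(m, n)) : R :=
  \sum_(i < m) \sum_(j < n) M i j ^+ 2.
Definition n2 (R : realType) m n (M : 'M[R]_(m, n)) : R := Num.sqrt (sqn2 M).
Definition dotm (R : realType) m n (M N : 'M[R]_(m, n)) : R :=
  \sum_(i < m) \sum_(j < n) M i j * N i j.

Definition opnorm_inf2 (R : realType) m n (B : 'M[R]_(m, n)) : R :=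
  sup [set n2 (B *m u) | u in [set u : 'cV[R]_n | ninf u <= 1]].

Definition gradv (R : realType) d (f : 'rV[R]_d -> R) (th : 'rV[R]_d) : 'rV[R]_d :=
  \row_(i < d) 'D_(delta_mx 0 i) f th.
Definition gradm (R : realType) S A (F : 'M[R]_(S, A) -> R) (l : 'M[R]_(S, A))
  : 'M[R]_(S, A) := \matrix_(s < S, a < A) 'D_(delta_mx s a) F l.

Definition is_distr (R : realType) n (v : 'rV[R]_n) : Prop :=
  (forall i, 0 <= v 0 i) /\ \sum_(i < n) v 0 i = 1.
Definition is_stochastic (R : realType) m n (M : 'M[R]_(m, n)) : Prop :=
  forall i, is_distr (row i M).

Definition rseries (R : realType) (u : nat -> R) : R :=
  limn (fun N => \sum_(t < N) u t).

Definition sa_next (R : realType) S A (P : 'I_A -> 'M[R]_S) (p : 'M[R]_(S, A))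
  (mu : 'M[R]_(S, A)) : 'M[R]_(S, A) :=
  \matrix_(s' < S, a' < A) \sum_(s < S) \sum_(a < A) mu s a * P a s s' * p s' a'.
Definition sa_dist (R : realType) S A (P : 'I_A -> 'M[R]_S) (p : 'M[R]_(S, A))
  (mu0 : 'M[R]_(S, A)) (t : nat) : 'M[R]_(S, A) := iter t (sa_next P p) mu0.
Definition init_sa (R : realType) S A (xi : 'rV[R]_S) (p : 'M[R]_(S, A)) : 'M[R]_(S, A) :=
  \matrix_(s < S, a < A) (xi 0 s * p s a).

Definition occupancy (R : realType) S A (P : 'I_A -> 'M[R]_S) (xi : 'rV[R]_S)
  (gamma : R) (p : 'M[R]_(S, A)) : 'M[R]_(S, A) :=
  \matrix_(s < S, a < A)
    rseries (fun t => gamma ^+ t * sa_dist P p (init_sa xi p) t s a).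

Definition Qfun (R : realType) S A (P : 'I_A -> 'M[R]_S) (gamma : R)
  (p : 'M[R]_(S, A)) (z : 'M[R]_(S, A)) (s : 'I_S) (a : 'I_A) : R :=
  rseries (fun t => gamma ^+ t *
    \sum_(s' < S) \sum_(a' < A) sa_dist P p (delta_mx s a) t s' a' * z s' a').

Definition Fconj (R : realType) S A (F : 'M[R]_(S, A) -> R) (z : 'M[R]_(S, A))
  : \bar R :=
  ereal_inf [set ((dotm l z - F l)%:E) | l in [set: 'M[R]_(S, A)]].

Definition traj S A K := {ffun 'I_K.+1 -> 'I_S * 'I_A}.
Definition sample S A K n := {ffun 'I_n -> traj S A K}.

Definition traj_prob (R : realType) S A K (P : 'I_A -> 'M[R]_S) (xi : 'rV[R]_S)
  (p : 'M[R]_(S, A)) (tau : traj S A K) : R :=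
  xi 0 (tau ord0).1 * p (tau ord0).1 (tau ord0).2 *
  \prod_(k < K)
    (P (tau (widen_ord (leqnSn K) k)).2 (tau (widen_ord (leqnSn K) k)).1
         (tau (lift ord0 k)).1
     * p (tau (lift ord0 k)).1 (tau (lift ord0 k)).2).

Definition sample_prob (R : realType) S A K n (P : 'I_A -> 'M[R]_S) (xi : 'rV[R]_S)
  (p : 'M[R]_(S, A)) (w : sample S A K n) : R :=
  \prod_(i < n) traj_prob P xi p (w i).

Definition Esample (R : realType) S A K n (P : 'I_A -> 'M[R]_S) (xi : 'rV[R]_S)
  (p : 'M[R]_(S, A)) (f : sample S A K n -> R) : R :=
  \sum_(w : sample S A K n) sample_prob P xi p w * f w.

Definition Vtilde (R : realType) S A K n (gamma : R) (z : 'M[R]_(S, A))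
  (w : sample S A K n) : R :=
  n%:R^-1 * \sum_(i < n) \sum_(k < K.+1) gamma ^+ k * z (w i k).1 (w i k).2.

Definition gradVtilde (R : realType) S A K n d (P : 'I_A -> 'M[R]_S) (gamma : R)
  (pi : 'rV[R]_d -> 'M[R]_(S, A)) (theta : 'rV[R]_d) (z : 'M[R]_(S, A))
  (w : sample S A K n) : 'rV[R]_d :=
  n%:R^-1 *: \sum_(i < n) \sum_(k < K.+1) \sum_(a < A)
     (gamma ^+ k * Qfun P gamma (pi theta) z (w i k).1 a)
       *: gradv (fun th => pi th (w i k).1 a) theta.

Definition est_obj (R : realType) S A K n d (P : 'I_A -> 'M[R]_S) (gamma : R)
  (pi : 'rV[R]_d -> 'M[R]_(S, A)) (theta : 'rV[R]_d) (F : 'M[R]_(S, A) -> R)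
  (lF : R) (w : sample S A K n) (delta : R) (x : 'rV[R]_d) : \bar R :=
  ereal_inf [set (- Fconj F z +
                  (Vtilde gamma z w
                   + delta * dotm (gradVtilde P gamma pi theta z w) x
                   - delta / 2 * sqn2 x)%:E)%E
            | z in [set z : 'M[R]_(S, A) | ninf z <= lF]].

Definition is_argmax (R : realType) d (f : 'rV[R]_d -> \bar R) (x : 'rV[R]_d) : Prop :=
  forall y, (f y <= f x)%E.

Definition is_limit_of_argmax (R : realType) d (Phi : R -> 'rV[R]_d -> \bar R)
  (g : 'rV[R]_d) : Prop :=
  (forall delta, 0 < delta -> exists x, is_argmax (Phi delta) x) /\
  (forall eps, 0 < eps -> exists eta, 0 < eta /\
     forall delta x, 0 < delta -> delta < eta -> is_argmax (Phi delta) x ->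
       n2 (x - g) <= eps).

Definition concave_fun (R : realType) S A (F : 'M[R]_(S, A) -> R) : Prop :=
  forall l l' (t : R), 0 <= t -> t <= 1 ->
    t * F l + (1 - t) * F l' <= F (t *: l + (1 - t) *: l').

(* Main.v *)
(* Write lambda~ for the empirical discounted occupancy and G(mu) z for the
   policy-gradient functional sum_s mu(s) sum_a Q(s,a;z) grad pi(a|s).  Fenchel
   duality places the objective of the estimator between
   F(lambda~ + delta G(lambda~)^T x) - delta/2 |x|^2 and the same expression with
   F replaced by its tangent at lambda~, so the maximizers tend to
   G(lambda~) (grad F(lambda~)), whereas the exact gradient is
   G(lambda) (grad F(lambda)).  The part of the error linear in lambda~ - lambda
   is a variance of an average of bounded vectors.  The part coming from
   grad F(lambda~) - grad F(lambda) must not depend on the dimension, which rules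
   out concentration of lambda~ in the l1 norm: by cocoercivity its square is
   controlled by a Bregman gap, and the mean of that gap is a generalization gap,
   of order 1/n because grad F(lambda~) moves by O(1/n) in the sup norm when one
   episode is replaced by an independent copy.  Truncation at K costs
   gamma^(K+1)/(1-gamma) in l1 norm. *)

Require Import Defs.
From HB Require Import structures.
From mathcomp Require Import all_boot all_order all_algebra.
From mathcomp Require Import all_classical all_reals all_analysis.
From mathcomp Require Import ring lra.
Import Order.TTheory GRing.Theory Num.Theory.
Import numFieldNormedType.Exports.
Local Open Scope classical_set_scope.
Local Open Scope ring_scope.

Set Implicit Arguments.
Unset Strict Implicit.
Unset Printing Implicit Defensive.

(** * Norms, concavity and smoothness *)

Section MatrixNorms.
Context {R : realType} {m n : nat}.
Implicit Types (M N : 'M[R]_(m, n)) (c : R).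

Lemma ninf_ge M i j : `|M i j| <= ninf M.
Proof.
apply: le_trans (le_bigmax _ (fun i => \big[Num.max/0]_(j < n) `|M i j|) i).
exact: (le_bigmax _ (fun j => `|M i j|) j).
Qed.

Lemma ninf_le M c : 0 <= c -> (forall i j, `|M i j| <= c) -> ninf M <= c.
Proof.
move=> c0 Mc; apply/bigmax_leP; split=> // i _.
by apply/bigmax_leP; split=> // j _; exact: Mc.
Qed.

Lemma ninf_ge0 M : 0 <= ninf M.
Proof. by apply/bigmax_geP; left. Qed.

Lemma n1_ge0 M : 0 <= n1 M.
Proof. by rewrite /n1 !sumr_ge0// => i _; rewrite sumr_ge0. Qed.

Lemma n1D M N : n1 (M + N) <= n1 M + n1 N.
Proof.
rewrite /n1 -big_split/=; apply: ler_sum => i _.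
by rewrite -big_split/=; apply: ler_sum => j _; rewrite mxE ler_normD.
Qed.

Lemma n1Z c M : n1 (c *: M) = `|c| * n1 M.
Proof.
rewrite /n1 mulr_sumr; apply: eq_bigr => i _; rewrite mulr_sumr.
by apply: eq_bigr => j _; rewrite mxE normrM.
Qed.

Lemma n1N M : n1 (- M) = n1 M.
Proof. by rewrite -scaleN1r n1Z normrN1 mul1r. Qed.

Lemma n1B M N : n1 (M - N) <= n1 M + n1 N.
Proof. by rewrite (le_trans (n1D _ _))// n1N. Qed.

Lemma n10 : n1 (0 : 'M[R]_(m, n)) = 0.
Proof. by rewrite -(scale0r 0) n1Z normr0 mul0r. Qed.

Lemma n1_sum (I : finType) (F : I -> 'M[R]_(m, n)) :
  n1 (\sum_i F i) <= \sum_i n1 (F i).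
Proof.
elim/big_rec2: _ => [|i y1 y2 _ le12]; first by rewrite n10.
by rewrite (le_trans (n1D _ _))// lerD2l.
Qed.

Lemma ler_n1 M i j : `|M i j| <= n1 M.
Proof.
rewrite /n1 (bigD1 i)//= (bigD1 j)//= -addrA lerDl addr_ge0//.
  by rewrite sumr_ge0.
by rewrite sumr_ge0// => k _; rewrite sumr_ge0.
Qed.

Lemma dotmC M N : dotm M N = dotm N M.
Proof.
by rewrite /dotm; apply: eq_bigr => i _; apply: eq_bigr => j _; rewrite mulrC.
Qed.

Lemma dotm_is_linear M : linear_for *%R (dotm M).
Proof.
move=> c N N'; rewrite /dotm mulr_sumr -big_split/=; apply: eq_bigr => i _.
rewrite mulr_sumr -big_split/=; apply: eq_bigr => j _; rewrite !mxE; ring.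
Qed.

HB.instance Definition _ M :=
  GRing.isLinear.Build R 'M[R]_(m, n) R *%R (dotm M) (dotm_is_linear M).

Lemma dotmDl M M' N : dotm (M + M') N = dotm M N + dotm M' N.
Proof. by rewrite !(dotmC _ N) linearD. Qed.

Lemma dotmBl M M' N : dotm (M - M') N = dotm M N - dotm M' N.
Proof. by rewrite !(dotmC _ N) linearB. Qed.

Lemma dotmZl c M N : dotm (c *: M) N = c * dotm M N.
Proof. by rewrite !(dotmC _ N) linearZ. Qed.

Lemma dotm_suml (I : finType) (F : I -> 'M[R]_(m, n)) N :
  dotm (\sum_i F i) N = \sum_i dotm (F i) N.
Proof. by rewrite dotmC linear_sum; apply: eq_bigr => i _; rewrite dotmC. Qed.

Lemma dotm_delta i j M : dotm (delta_mx i j) M = M i j.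
Proof.
rewrite /dotm (bigD1 i)//= (bigD1 j)//= !mxE !eqxx mul1r.
rewrite !big1 ?addr0// => [k /negPf ki|k /negPf kj].
  by rewrite big1// => l _; rewrite mxE ki mul0r.
by rewrite mxE kj andbF mul0r.
Qed.

Lemma n1_delta i j : n1 (delta_mx i j : 'M[R]_(m, n)) = 1.
Proof.
rewrite -[RHS](_ : dotm (delta_mx i j) (const_mx 1) = 1).
  apply: eq_bigr => k _; apply: eq_bigr => l _; rewrite !mxE mulr1.
  by rewrite normr_nat.
by rewrite dotm_delta mxE.
Qed.

Lemma ler_dotm M N : `|dotm M N| <= n1 M * ninf N.
Proof.
rewrite /dotm /n1 mulr_suml (le_trans (ler_norm_sum _ _ _))//.
apply: ler_sum => i _; rewrite mulr_suml (le_trans (ler_norm_sum _ _ _))//.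
by apply: ler_sum => j _; rewrite normrM ler_wpM2l// ninf_ge.
Qed.

Lemma sqn2E M : sqn2 M = dotm M M.
Proof. by []. Qed.

Lemma sqn2_ge0 M : 0 <= sqn2 M.
Proof. by apply: sumr_ge0 => i _; apply: sumr_ge0 => j _; rewrite sqr_ge0. Qed.

Lemma sqn2B M N : sqn2 (M - N) = sqn2 M - 2 * dotm M N + sqn2 N.
Proof.
rewrite !sqn2E dotmBl !linearB/= (dotmC N M); ring.
Qed.

Lemma sqn2N M : sqn2 (- M) = sqn2 M.
Proof. by rewrite !sqn2E linearN/= dotmC linearN/= opprK. Qed.

Lemma sqn2Z c M : sqn2 (c *: M) = c ^+ 2 * sqn2 M.
Proof. by rewrite !sqn2E linearZ/= dotmZl mulrA. Qed.

Lemma ler_dotm_sqn2 M N : dotm M N <= (sqn2 M + sqn2 N) / 2.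
Proof. have := sqn2_ge0 (M - N); rewrite sqn2B; lra. Qed.

Lemma ler_norm_dotm_sqn2 M N : `|dotm M N| <= (sqn2 M + sqn2 N) / 2.
Proof.
rewrite ler_norml ler_dotm_sqn2 andbT lerNl.
by have := ler_dotm_sqn2 (- M) N; rewrite sqn2N dotmC linearN/= dotmC.
Qed.

Lemma sqn2D_le M N : sqn2 (M + N) <= 2 * (sqn2 M + sqn2 N).
Proof.
have := ler_dotm_sqn2 M N; have := sqn2B M (- N).
rewrite opprK sqn2N linearN/=; lra.
Qed.

Lemma sqn2D4_le M1 M2 M3 M4 :
  sqn2 (M1 + M2 + (M3 + M4)) <= 4 * (sqn2 M1 + sqn2 M2 + sqn2 M3 + sqn2 M4).
Proof.
have := sqn2D_le (M1 + M2) (M3 + M4).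
have := sqn2D_le M1 M2; have := sqn2D_le M3 M4; lra.
Qed.

(** Expanding the square gives a double sum of inner products, each at most [D] by the
    arithmetic-geometric mean inequality. Only the total weight of the coefficients enters, whatever
    the number of terms. *)
Lemma sqn2_sum_le (I : finType) (c : I -> R) (v : I -> 'M[R]_(m, n)) D :
  (forall i, sqn2 (v i) <= D) ->
  sqn2 (\sum_i c i *: v i) <= (\sum_i `|c i|) ^+ 2 * D.
Proof.
move=> vD; rewrite sqn2E linear_sum/= expr2 !mulr_suml.
apply: ler_sum => i _; rewrite -mulrA mulr_suml mulr_sumr dotm_suml.
apply: ler_sum => j _; rewrite linearZ/= dotmZl.
apply: le_trans (ler_norm _) _; rewrite !normrM !ler_wpM2l//.
have := ler_norm_dotm_sqn2 (v j) (v i); have := vD i; have := vD j; lra.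
Qed.

Lemma ler_entry_n2 M i j : `|M i j| <= n2 M.
Proof.
rewrite /n2 -sqrtr_sqr ler_wsqrtr//.
rewrite /sqn2 (bigD1 i)//= (bigD1 j)//= -addrA lerDl addr_ge0//.
  by apply: sumr_ge0 => k _; rewrite sqr_ge0.
by apply: sumr_ge0 => k _; apply: sumr_ge0 => l _; rewrite sqr_ge0.
Qed.

End MatrixNorms.

(** * Tangent bounds and cocoercivity for smooth concave functions *)

Section ConcaveSmooth.
Context {R : realType} {S A : nat}.
Variable F : 'M[R]_(S, A) -> R.
Hypothesis dF : forall l, differentiable F l.

Lemma derive_gradm l v : 'D_v F l = dotm (gradm F l) v.
Proof.
rewrite deriveE// {1}(matrix_sum_delta v) linear_sum/=.
apply: eq_bigr => i _; rewrite linear_sum/=; apply: eq_bigr => j _.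
by rewrite linearZ/= mxE deriveE// mulrC.
Qed.

Hypothesis cF : concave_fun F.

(** By concavity every difference quotient of [F] from [x] towards [y], with step in (0, 1], is at
    least [F y - F x]; the directional derivative is their limit. *)
Lemma concave_le_tangent x y : F y <= F x + dotm (gradm F x) (y - x).
Proof.
rewrite -lerBlDl -derive_gradm.
have dFx : derivable F x (y - x) by exact: diff_derivable.
(* Concavity controls the quotients for positive steps, so the punctured limit is restricted to the
   right of 0. *)
have cv : h^-1 *: ((F \o shift x) (h *: (y - x)) - F x) @[h --> 0^'+]
    --> 'D_(y - x) F x.
  apply: cvg_trans dFx; apply: cvg_app.
  by move=> U [e e0 eU]; exists e => // z ez z0; apply: eU => //; rewrite gt_eqF.
rewrite -(cvg_lim _ cv)//; apply: limr_ge; first exact: cvgP cv.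
near=> t.
have t0 : 0 < t by near: t; exact: nbhs_right_gt.
have t1 : t <= 1 by near: t; exact: nbhs_right_le.
rewrite -[leRHS]/(t^-1 * _) mulrC ler_pdivlMr//.
have := cF y x (ltW t0) t1.
have -> : t *: y + (1 - t) *: x = t *: (y - x) + x.
  by apply/matrixP => i j; rewrite !mxE; ring.
rewrite /=; lra.
Unshelve. all: by end_near. Qed.

Variable LF : R.
Hypothesis LF0 : 0 <= LF.
Hypothesis sF : forall l l', ninf (gradm F l - gradm F l') <= LF * n1 (l - l').

(** The tangent at [x + h] bounds [F x] from above; exchanging its slope for the one at [x] costs
    [LF * n1 h ^+ 2] by l1/sup duality. The constant is twice the sharp one, but no integration
    along the segment is involved. *)
Lemma smooth_ge_tangent x h :
  F x + dotm (gradm F x) h - LF * n1 h ^+ 2 <= F (x + h).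
Proof.
have := concave_le_tangent (x + h) x.
rewrite opprD addrA subrr add0r linearN/= => Fx.
have := ler_dotm h (gradm F (x + h) - gradm F x).
rewrite ler_norml [dotm h _]linearB/= !(dotmC h) => /andP[dh _].
have := sF (x + h) x; rewrite addrAC subrr add0r => Lh.
have := ler_wpM2l (n1_ge0 h) Lh; lra.
Qed.

(* Since F is concave, F - <grad F y, .> is maximal at y; the bound compares
   that maximum with its value after a gradient step from x. *)
Lemma cocoercive x y :
  ninf (gradm F x - gradm F y) ^+ 2
    <= 4 * LF * (F y + dotm (gradm F y) (x - y) - F x).
Proof.
set br := F y + _ - _.
have br0 : 0 <= br by rewrite subr_ge0 concave_le_tangent.
set G := gradm F x - gradm F y.
(* For the sup norm it is enough to step along one basis matrix, whose l1 norm is 1. *)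
suff entry i j : `|G i j| <= Num.sqrt (4 * LF * br).
  rewrite -(@sqr_sqrtr _ (4 * LF * br)); last by rewrite !mulr_ge0.
  rewrite ler_sqr ?nnegrE ?ninf_ge0 ?sqrtr_ge0//.
  by apply: ninf_le => //; exact: sqrtr_ge0.
rewrite -sqrtr_sqr ler_wsqrtr//.
(* The step length below divides by [LF]; for [LF = 0] the gradient is constant and [G] vanishes. *)
have [LF00|LFn0] := eqVneq LF 0.
  have := le_trans (ninf_ge G i j) (sF x y); rewrite LF00 !mul0r => G0.
  have /eqP : `|G i j| = 0 by apply/eqP; rewrite eq_le G0/=.
  by rewrite normr_eq0 mulr0 mul0r => /eqP ->; rewrite expr0n.
have LFgt0 : 0 < LF by rewrite lt_def LFn0.
(* This value maximizes [c * g - LF * c ^+ 2], with maximum [g ^+ 2 / (4 * LF)], whence the factor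
   [4 * LF]. *)
pose c := G i j / (2 * LF).
have := smooth_ge_tangent x (c *: delta_mx i j).
rewrite n1Z n1_delta mulr1 real_normK ?num_real// linearZ/= dotmC dotm_delta.
have := concave_le_tangent y (x + c *: delta_mx i j).
rewrite addrAC linearD/= linearZ/= [dotm _ (delta_mx _ _)]dotmC dotm_delta.
have : G i j = gradm F x i j - gradm F y i j by rewrite !mxE.
have : G i j = c * (2 * LF) by rewrite /c mulfVK// mulf_neq0.
move: (G i j) @c => g c gc gE up low.
have : c * g - LF * c ^+ 2 <= br by rewrite gE /br; lra.
rewrite gc => lec; have : 4 * LF * (c * (c * (2 * LF)) - LF * c ^+ 2)
  <= 4 * LF * br by rewrite ler_wpM2l// mulr_ge0.
lra.
Qed.

End ConcaveSmooth.

(** * Product measures, stability and Markov chains *)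

Section Stability.
Context {R : realType} {T : finType} {n : nat}.
Variable q : T -> R.
Hypothesis q_ge0 : forall t, 0 <= q t.
Hypothesis q_sum1 : \sum_t q t = 1.
Implicit Types (w : {ffun 'I_n -> T}) (t : T).

Definition prod_weight w : R := \prod_i q (w i).

Lemma prod_weight_ge0 w : 0 <= prod_weight w.
Proof. exact: prodr_ge0. Qed.

Lemma prod_weight_sum1 : \sum_w prod_weight w = 1.
Proof.
rewrite -(bigA_distr_bigA (fun _ : 'I_n => q)) big1// => i _; exact: q_sum1.
Qed.

Definition update w i t : {ffun 'I_n -> T} :=
  [ffun j => if j == i then t else w j].

Lemma prod_weight_update w i t :
  prod_weight (update w i t) * q (w i) = prod_weight w * q t.
Proof.
rewrite /prod_weight (bigD1 i)//= [in RHS](bigD1 i)//= ffunE eqxx.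
rewrite (eq_bigr (fun j => q (w j))); first by ring.
by move=> j /negPf ji; rewrite ffunE ji.
Qed.

(** Swapping the [i]-th draw with the fresh draw [t] is an involution on pairs that preserves their
    joint weight, so the double sum can be reindexed along it. *)
Lemma resample i (h : {ffun 'I_n -> T} -> T -> R) :
  \sum_w \sum_t prod_weight w * q t * h w t =
  \sum_w \sum_t prod_weight w * q t * h (update w i t) (w i).
Proof.
rewrite !pair_bigA/=.
pose s (x : {ffun 'I_n -> T} * T) := (update x.1 i x.2, x.1 i).
have sK : cancel s s.
  move=> [w t]; rewrite /s/= ffunE eqxx; congr pair; apply/ffunP => j.
  by rewrite !ffunE; case: eqP => // ->.
rewrite (reindex_inj (can_inj sK)); apply: eq_bigr => -[w t] _ /=.
by rewrite prod_weight_update.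
Qed.

(* Exchanging the i-th sample with an independent copy turns the population
   mean of f w into that of the perturbed f (update w i t) at w i. *)
Lemma stability_generalization (f : {ffun 'I_n -> T} -> T -> R) beta :
  (0 < n)%N ->
  (forall i w t, f w (w i) - f (update w i t) (w i) <= beta) ->
  \sum_w prod_weight w * (n%:R^-1 * \sum_i f w (w i) - \sum_t q t * f w t)
    <= beta.
Proof.
move=> n0 fbeta.
have n0R : n%:R != 0 :> R by rewrite pnatr_eq0 -lt0n.
have one i :
    \sum_w prod_weight w * (f w (w i) - \sum_t q t * f w t) <= beta.
  have -> : \sum_w prod_weight w * (f w (w i) - \sum_t q t * f w t) =
      \sum_w \sum_t prod_weight w * q t * (f w (w i) - f (update w i t) (w i)).
    transitivity (\sum_w \sum_t prod_weight w * q t * f w (w i) -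
                  \sum_w \sum_t prod_weight w * q t * f w t).
      rewrite -sumrB; apply: eq_bigr => w _; rewrite mulrBr; congr (_ - _).
        by rewrite -mulr_suml -mulr_sumr q_sum1 mulr1.
      by rewrite mulr_sumr; apply: eq_bigr => t _; rewrite mulrA.
    rewrite (resample i f) -sumrB; apply: eq_bigr => w _.
    by rewrite -sumrB; apply: eq_bigr => t _; rewrite mulrBr.
  apply: (@le_trans _ _ (\sum_w \sum_t prod_weight w * q t * beta)).
    apply: ler_sum => w _; apply: ler_sum => t _; rewrite ler_wpM2l//.
    by rewrite mulr_ge0// prod_weight_ge0.
  under eq_bigr do rewrite -mulr_suml -mulr_sumr q_sum1 mulr1.
  by rewrite -mulr_suml prod_weight_sum1 mul1r.
have -> : \sum_w prod_weight w *
      (n%:R^-1 * \sum_i f w (w i) - \sum_t q t * f w t) =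
    n%:R^-1 * \sum_i \sum_w prod_weight w * (f w (w i) - \sum_t q t * f w t).
  rewrite exchange_big/= mulr_sumr; apply: eq_bigr => w _.
  rewrite -mulr_sumr sumrB sumr_const card_ord -mulr_natr; field.
  exact: n0R.
rewrite ler_pdivrMl ?ltr0n//.
apply: le_trans (ler_sum _ (fun i _ => one i)) _.
by rewrite sumr_const card_ord mulr_natl.
Qed.

End Stability.

(** * Finite Markov chains: path weights and one-time marginals *)

Section Chain.
Context {R : realType} {X : finType}.
Variable kappa : X -> X -> R.
Hypothesis kappa_sum1 : forall x, \sum_y kappa x y = 1.

Definition chain_weight K (mu : X -> R) (tau : {ffun 'I_K.+1 -> X}) : R :=
  mu (tau ord0) * \prod_(k < K)
    kappa (tau (widen_ord (leqnSn K) k)) (tau (lift ord0 k)).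

Definition chain_step (mu : X -> R) : X -> R :=
  fun y => \sum_x mu x * kappa x y.

Definition ffun_cons K (x : X) (tau : {ffun 'I_K -> X}) : {ffun 'I_K.+1 -> X} :=
  [ffun i => if unlift ord0 i is Some j then tau j else x].

Lemma ffun_cons0 K x (tau : {ffun 'I_K -> X}) : ffun_cons x tau ord0 = x.
Proof. by rewrite ffunE unlift_none. Qed.

Lemma ffun_consS K x (tau : {ffun 'I_K -> X}) j :
  ffun_cons x tau (lift ord0 j) = tau j.
Proof. by rewrite ffunE liftK. Qed.

Lemma sum_ffun_cons K (G : {ffun 'I_K.+1 -> X} -> R) :
  \sum_tau G tau = \sum_x \sum_(tau : {ffun 'I_K -> X}) G (ffun_cons x tau).
Proof.
rewrite pair_bigA/=.
pose c (u : X * {ffun 'I_K -> X}) := ffun_cons u.1 u.2.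
pose d (tau : {ffun 'I_K.+1 -> X}) : X * {ffun 'I_K -> X} :=
  (tau ord0, [ffun j => tau (lift ord0 j)]).
rewrite (reindex_onto c d) => [|tau _]; last first.
  apply/ffunP => i; rewrite /c /d/= ffunE.
  by case: unliftP => [j ->|->]; rewrite ?ffunE.
apply: eq_bigl => -[x tau]; rewrite /c /d/= ffun_cons0.
apply/eqP; congr pair; apply/ffunP => j.
by rewrite ffunE ffun_consS.
Qed.

(** The first state is absorbed into a new, unnormalized initial weight; this is why [mu] ranges
    over arbitrary functions in the induction for the marginals. *)
Lemma chain_weight_cons K mu x (tau : {ffun 'I_K.+1 -> X}) :
  chain_weight mu (ffun_cons x tau) =
  chain_weight (fun y => mu x * kappa x y) tau.
Proof.
rewrite /chain_weight ffun_cons0 big_ord_recl/= mulrA; congr (_ * _ * _).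
  have -> : widen_ord (leqnSn K.+1) ord0 = ord0 by apply: val_inj.
  by rewrite ffun_cons0 ffun_consS.
apply: eq_bigr => k _.
have -> : widen_ord (leqnSn K.+1) (lift ord0 k) =
    lift ord0 (widen_ord (leqnSn K) k) by exact: val_inj.
by rewrite !ffun_consS.
Qed.

(** Induction on the length, peeling off the first state: for a later time its sum is one
    [chain_step], and for time 0 the rest of the path sums to 1. *)
Lemma chain_marginal K mu (k : 'I_K.+1) (f : X -> R) :
  \sum_tau chain_weight mu tau * f (tau k) =
  \sum_x iter k chain_step mu x * f x.
Proof.
elim: K mu k f => [|K IH] mu k f; rewrite sum_ffun_cons.
  rewrite (ord1 k)/=; apply: eq_bigr => x _.
  under eq_bigr do rewrite /chain_weight big_ord0 !ffun_cons0 mulr1.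
  by rewrite sumr_const card_ffun card_ord expn0 mulr1n.
under eq_bigr do under eq_bigr do rewrite chain_weight_cons.
case: (unliftP ord0 k) => [j ->|->].
  under eq_bigr do under eq_bigr do rewrite ffun_consS.
  under [RHS]eq_bigr do rewrite lift0 iterSr.
  rewrite exchange_big/= -IH; apply: eq_bigr => tau _.
  rewrite -mulr_suml; congr (_ * _).
  by rewrite /chain_weight -mulr_suml.
apply: eq_bigr => x _; under eq_bigr do rewrite ffun_cons0.
rewrite -mulr_suml; congr (_ * _); rewrite [RHS]/=.
(* Inserting the factor 1 lets the induction hypothesis, at time 0 and with a constant function, sum
   out the tail. *)
under eq_bigr do rewrite -[chain_weight _ _]mulr1.
rewrite (IH _ ord0 (fun=> 1))/=; under eq_bigr do rewrite mulr1.
by rewrite -mulr_sumr kappa_sum1 mulr1.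
Qed.

End Chain.

(** * Discounted occupancies *)

Lemma cvg_fsum {R : realType} {T : Type} {G : set_system T} {FG : Filter G}
    (I : finType) (f : I -> T -> R) (l : I -> R) :
  (forall i, f i x @[x --> G] --> l i) ->
  \sum_i f i x @[x --> G] --> \sum_i l i.
Proof. by move=> fl; apply: cvg_big => //; exact: add_continuous. Qed.

Lemma stochastic_ge0 {R : realType} m n (M : 'M[R]_(m, n)) i j :
  is_stochastic M -> 0 <= M i j.
Proof. by move=> /(_ i)[/(_ j)]; rewrite mxE. Qed.

Lemma stochastic_sum1 {R : realType} m n (M : 'M[R]_(m, n)) i :
  is_stochastic M -> \sum_j M i j = 1.
Proof. by move=> /(_ i)[_ <-]; apply: eq_bigr => j _; rewrite mxE. Qed.

Section Discounted.
Context {R : realType} {S A : nat}.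
Variables (P : 'I_A -> 'M[R]_S) (gamma : R).
Hypothesis Pst : forall a, is_stochastic (P a).
Hypotheses (gamma_gt0 : 0 < gamma) (gamma_lt1 : gamma < 1).
Implicit Types (p mu nu z X : 'M[R]_(S, A)).

Lemma sa_next_linear p c mu nu :
  sa_next P p (c *: mu + nu) = c *: sa_next P p mu + sa_next P p nu.
Proof.
apply/matrixP => s' a'; rewrite !mxE mulr_sumr -big_split/=.
apply: eq_bigr => s _; rewrite mulr_sumr -big_split/=.
by apply: eq_bigr => a _; rewrite !mxE; ring.
Qed.

Lemma sa_dist_linear p c mu nu t :
  sa_dist P p (c *: mu + nu) t = c *: sa_dist P p mu t + sa_dist P p nu t.
Proof. by elim: t => //= t; rewrite /sa_dist/= => ->; exact: sa_next_linear. Qed.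

Lemma sa_dist_next p mu t : sa_dist P p (sa_next P p mu) t = sa_dist P p mu t.+1.
Proof. by rewrite /sa_dist iterSr. Qed.

(** The kernel is nonnegative with unit row sums, hence an l1 contraction. [mu] may be signed, as
    the perturbations caused by a change of policy are. *)
Lemma n1_sa_next p mu : is_stochastic p -> n1 (sa_next P p mu) <= n1 mu.
Proof.
move=> pst; rewrite {1}/n1.
apply: (@le_trans _ _ (\sum_s' \sum_a' \sum_s \sum_a
    `|mu s a| * P a s s' * p s' a')).
  apply: ler_sum => s' _; apply: ler_sum => a' _; rewrite mxE.
  apply: le_trans (ler_norm_sum _ _ _) _; apply: ler_sum => s _.
  apply: le_trans (ler_norm_sum _ _ _) _; apply: ler_sum => a _.
  by rewrite !normrM ![`|P _ _ _|]ger0_norm ?[`|p _ _|]ger0_norm ?stochastic_ge0.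
rewrite le_eqVlt; apply/orP; left; apply/eqP.
transitivity (\sum_s' \sum_s \sum_a `|mu s a| * P a s s').
  apply: eq_bigr => s' _; rewrite exchange_big/=; apply: eq_bigr => s _.
  rewrite exchange_big/=; apply: eq_bigr => a _.
  by rewrite -mulr_sumr stochastic_sum1// mulr1.
rewrite exchange_big/=; apply: eq_bigr => s _.
rewrite exchange_big/=; apply: eq_bigr => a _.
by rewrite -mulr_sumr stochastic_sum1// mulr1.
Qed.

Lemma n1_sa_dist p mu t : is_stochastic p -> n1 (sa_dist P p mu t) <= n1 mu.
Proof.
move=> pst; elim: t => //= t; apply: le_trans.
by rewrite /sa_dist/=; exact: n1_sa_next.
Qed.

Definition discounted_partial p mu (N : nat) : 'M[R]_(S, A) :=
  \sum_(t < N) gamma ^+ t *: sa_dist P p mu t.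

(** The resolvent of the state-action chain, applied to an arbitrary signed mass; at [init_sa xi p]
    it is the occupancy measure. *)
Definition discounted p mu : 'M[R]_(S, A) :=
  \matrix_(s, a) rseries (fun t => gamma ^+ t * sa_dist P p mu t s a).

Lemma discounted_partialE p mu N s a :
  discounted_partial p mu N s a =
  \sum_(t < N) gamma ^+ t * sa_dist P p mu t s a.
Proof. by rewrite summxE; apply: eq_bigr => t _; rewrite mxE. Qed.

Lemma geometric_sum_le N : \sum_(t < N) gamma ^+ t <= (1 - gamma)^-1.
Proof.
have g0 : 0 < 1 - gamma by rewrite subr_gt0.
rewrite -[leRHS]mul1r ler_pdivlMr// mulrC -opprB mulNr -subrX1 opprB.
by rewrite lerBlDl lerDr exprn_ge0// ltW.
Qed.

Lemma cvg_discounted p mu s a : is_stochastic p ->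
  discounted_partial p mu N s a @[N --> \oo] --> discounted p mu s a.
Proof.
move=> pst; rewrite mxE /rseries.
pose u t := gamma ^+ t * sa_dist P p mu t s a.
have -> : (fun N => discounted_partial p mu N s a) = series u.
  by apply/funext => N; rewrite discounted_partialE seriesEord.
rewrite (_ : (fun N => \sum_(t < N) _) = series u); last by rewrite seriesEord.
suff : cvgn (series u) by [].
apply: normed_cvg; rewrite /normed_series_of.
apply: (@series_le_cvg _ _ (geometric (n1 mu) gamma)) => [t|t|t|].
- exact: normr_ge0.
- by rewrite geometric_ge0 ?n1_ge0// ltW.
- rewrite /geometric/= /u normrM ger0_norm ?exprn_ge0 ?(ltW gamma_gt0)// mulrC.
  rewrite ler_wpM2r ?exprn_ge0 ?(ltW gamma_gt0)//.
  exact: le_trans (ler_n1 _ _ _) (n1_sa_dist _ _ pst).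
- by apply: is_cvg_geometric_series; rewrite ger0_norm// ltW.
Qed.

Lemma cvg_discounted_unique p mu X : is_stochastic p ->
  (forall s a, discounted_partial p mu N s a @[N --> \oo] --> X s a) ->
  discounted p mu = X.
Proof.
move=> pst cX; apply/matrixP => s a.
by rewrite -(cvg_lim _ (cX s a))//; apply/esym/cvg_lim => //; exact: cvg_discounted.
Qed.

Lemma discounted_linear p c mu nu : is_stochastic p ->
  discounted p (c *: mu + nu) = c *: discounted p mu + discounted p nu.
Proof.
move=> pst; apply: cvg_discounted_unique => // s a.
have -> : (c *: discounted p mu + discounted p nu) s a =
  c * discounted p mu s a + discounted p nu s a by rewrite !mxE.
have -> : (fun N => discounted_partial p (c *: mu + nu) N s a) = (fun N =>
    c * discounted_partial p mu N s a + discounted_partial p nu N s a).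
  apply/funext => N; rewrite !discounted_partialE mulr_sumr -big_split/=.
  by apply: eq_bigr => t _; rewrite sa_dist_linear !mxE; ring.
apply: cvgD; last exact: cvg_discounted.
by apply: cvgMl_tmp; exact: cvg_discounted.
Qed.

Lemma discountedD p mu nu : is_stochastic p ->
  discounted p (mu + nu) = discounted p mu + discounted p nu.
Proof. by move=> pst; rewrite -[mu in LHS]scale1r discounted_linear ?scale1r. Qed.

Lemma discounted0 p : is_stochastic p -> discounted p 0 = 0.
Proof.
move=> pst; have := discountedD 0 0 pst; rewrite addr0 => /eqP.
by rewrite addrC -subr_eq subrr => /eqP.
Qed.

Lemma discountedZ p c mu : is_stochastic p ->
  discounted p (c *: mu) = c *: discounted p mu.
Proof.
by move=> pst; rewrite -[c *: mu]addr0 discounted_linear// discounted0// addr0.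
Qed.

Lemma discounted_sum p (I : finType) (f : I -> 'M[R]_(S, A)) : is_stochastic p ->
  discounted p (\sum_i f i) = \sum_i discounted p (f i).
Proof.
move=> pst; apply: (big_morph (discounted p)); last exact: discounted0.
by move=> x y; exact: discountedD.
Qed.

Lemma discounted_unfold p mu : is_stochastic p ->
  discounted p mu = mu + gamma *: discounted p (sa_next P p mu).
Proof.
move=> pst; apply: cvg_discounted_unique => // s a.
have -> : (mu + gamma *: discounted p (sa_next P p mu)) s a =
  mu s a + gamma * discounted p (sa_next P p mu) s a by rewrite !mxE.
rewrite -cvg_shiftS.
have -> : (fun N => discounted_partial p mu N.+1 s a) = (fun N =>
    mu s a + gamma * discounted_partial p (sa_next P p mu) N s a).
  apply/funext => N; rewrite !discounted_partialE big_ord_recl/= expr0 mul1r.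
  congr (_ + _); rewrite mulr_sumr; apply: eq_bigr => t _.
  by rewrite sa_dist_next mulrA -exprS.
apply: cvgD; first exact: cvg_cst.
by apply: cvgMl_tmp; exact: cvg_discounted.
Qed.

Lemma discounted_iter p mu N : is_stochastic p ->
  discounted p mu =
  discounted_partial p mu N + gamma ^+ N *: discounted p (sa_dist P p mu N).
Proof.
move=> pst; elim: N => [|N IH].
  by rewrite /discounted_partial big_ord0 add0r expr0 scale1r.
rewrite IH /discounted_partial big_ord_recr/= [in LHS]discounted_unfold//.
by rewrite scalerDr addrA scalerA -exprSr.
Qed.

(** Commuting the resolvent with one transition turns [discounted_unfold] into the flow equation
    satisfied by the occupancy measure itself. *)
Lemma discounted_sa_next p mu : is_stochastic p ->
  discounted p (sa_next P p mu) = sa_next P p (discounted p mu).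
Proof.
move=> pst; apply: cvg_discounted_unique => // s' a'; rewrite mxE.
have -> : (fun N => discounted_partial p (sa_next P p mu) N s' a') = (fun N =>
    \sum_s \sum_a discounted_partial p mu N s a * P a s s' * p s' a').
  apply/funext => N; rewrite discounted_partialE.
  under [RHS]eq_bigr do under eq_bigr do
    rewrite discounted_partialE -mulrA mulr_suml.
  under [RHS]eq_bigr do rewrite exchange_big/=.
  rewrite [RHS]exchange_big/=; apply: eq_bigr => t _.
  rewrite sa_dist_next /sa_dist/= mxE mulr_sumr; apply: eq_bigr => s _.
  by rewrite mulr_sumr; apply: eq_bigr => a _; rewrite !mulrA.
apply: cvg_fsum => s; apply: cvg_fsum => a.
by apply: cvgMr_tmp; apply: cvgMr_tmp; exact: cvg_discounted.
Qed.

Lemma n1_discounted_partial p mu N : is_stochastic p ->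
  n1 (discounted_partial p mu N) <= n1 mu / (1 - gamma).
Proof.
move=> pst; apply: le_trans (n1_sum _) _.
apply: (@le_trans _ _ (\sum_(t < N) gamma ^+ t * n1 mu)).
  apply: ler_sum => t _; rewrite n1Z ger0_norm ?exprn_ge0 ?(ltW gamma_gt0)//.
  by rewrite ler_wpM2l ?exprn_ge0 ?(ltW gamma_gt0)// n1_sa_dist.
rewrite -mulr_suml mulrC ler_wpM2l ?n1_ge0//.
exact: geometric_sum_le.
Qed.

Lemma n1_discounted p mu : is_stochastic p ->
  n1 (discounted p mu) <= n1 mu / (1 - gamma).
Proof.
move=> pst.
have c : n1 (discounted_partial p mu N) @[N --> \oo] --> n1 (discounted p mu).
  apply: cvg_fsum => s; apply: cvg_fsum => a.
  by apply: cvg_norm; exact: cvg_discounted.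
by apply: (cvgr_to_le c); apply: nearW => N; exact: n1_discounted_partial.
Qed.

(** Writing Q-values as pairings of [z] with the resolvent of a point mass makes linearity in [z]
    and the sup bound immediate. *)
Lemma Qfun_discounted p z s a : is_stochastic p ->
  Qfun P gamma p z s a = dotm (discounted p (delta_mx s a)) z.
Proof.
move=> pst; apply: cvg_lim => //.
have -> : (fun N => \sum_(t < N) gamma ^+ t *
    \sum_s' \sum_a' sa_dist P p (delta_mx s a) t s' a' * z s' a') =
  (fun N => dotm (discounted_partial p (delta_mx s a) N) z).
  apply/funext => N; rewrite dotm_suml; apply: eq_bigr => t _.
  by rewrite dotmZl.
apply: cvg_fsum => s'; apply: cvg_fsum => a'.
by apply: cvgMr_tmp; exact: cvg_discounted.
Qed.

Lemma dotm_discounted p mu z : is_stochastic p ->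
  dotm (discounted p mu) z = \sum_s \sum_a mu s a * Qfun P gamma p z s a.
Proof.
move=> pst; rewrite {1}(matrix_sum_delta mu) discounted_sum// dotm_suml.
apply: eq_bigr => s _; rewrite discounted_sum// dotm_suml.
by apply: eq_bigr => a _; rewrite discountedZ// dotmZl Qfun_discounted.
Qed.

Lemma Qfun_le p z s a : is_stochastic p ->
  `|Qfun P gamma p z s a| <= ninf z / (1 - gamma).
Proof.
move=> pst; rewrite Qfun_discounted//; apply: le_trans (ler_dotm _ _) _.
rewrite mulrC ler_wpM2l ?ninf_ge0// (le_trans (n1_discounted _ pst))//.
by rewrite n1_delta mul1r.
Qed.

Variable xi : 'rV[R]_S.
Hypothesis xi_distr : is_distr xi.

Lemma n1_init_sa p : is_stochastic p -> n1 (init_sa xi p) = 1.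
Proof.
case: xi_distr => xi0 xi1 pst; rewrite -[RHS]xi1; apply: eq_bigr => s _.
have e a : `|init_sa xi p s a| = xi 0 s * p s a.
  by rewrite mxE ger0_norm// mulr_ge0// stochastic_ge0.
under eq_bigr do rewrite e.
by rewrite -mulr_sumr stochastic_sum1// mulr1.
Qed.

Lemma n1_occupancy p : is_stochastic p ->
  n1 (occupancy P xi gamma p) <= (1 - gamma)^-1.
Proof.
by move=> pst; rewrite (le_trans (n1_discounted _ pst))// n1_init_sa// mul1r.
Qed.

Definition state_flow mu (s : 'I_S) : R := \sum_a mu s a.

Lemma sum_state_flow mu : \sum_s `|state_flow mu s| <= n1 mu.
Proof. by apply: ler_sum => s _; exact: ler_norm_sum. Qed.

(* l' also solves the flow equation of p, with the initial mass perturbed by the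
   change of policy at the states visited under p'. *)
Lemma occupancy_performance_difference p p' :
  is_stochastic p -> is_stochastic p' ->
  let l := occupancy P xi gamma p in let l' := occupancy P xi gamma p' in
  l' - l = discounted p (\matrix_(s, a) (state_flow l' s * (p' s a - p s a))).
Proof.
move=> pst pst' l l'.
have l'E : l' = init_sa xi p' + gamma *: sa_next P p' l'.
  by rewrite -discounted_sa_next//; exact: discounted_unfold.
have l'sa s a : l' s a =
    (xi 0 s + gamma * \sum_s' \sum_a' l' s' a' * P a' s' s) * p' s a.
  rewrite {1}l'E !mxE mulrDl; congr (_ + _); rewrite -mulrA; congr (_ * _).
  by rewrite mulr_suml; apply: eq_bigr => s' _; rewrite mulr_suml.
have rho s : state_flow l' s =
    xi 0 s + gamma * \sum_s' \sum_a' l' s' a' * P a' s' s.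
  rewrite /state_flow; under eq_bigr do rewrite l'sa.
  by rewrite -mulr_sumr stochastic_sum1// mulr1.
set e := \matrix_(_, _) _.
(* Replacing [p'] by [p] in the flow equation of [l'] leaves exactly the defect [e]. *)
have l'p : l' = init_sa xi p + e + gamma *: sa_next P p l'.
  apply/matrixP => s a; rewrite l'sa !mxE rho.
  under [X in _ = _ + _ * X]eq_bigr do rewrite -mulr_suml.
  by rewrite -mulr_suml; ring.
(* Applying the resolvent of [p] to [l'p] and comparing with its unfolding at [l'] cancels the
   common term; what remains is [l' = discounted p (init_sa xi p) + discounted p e]. *)
have : discounted p l' = l' + gamma *: discounted p (sa_next P p l').
  exact: discounted_unfold.
rewrite {1}l'p !discountedD// discountedZ// => /addIr <-.
by rewrite addrAC subrr add0r.
Qed.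

(** One factor [(1 - gamma)^-1] is the l1 norm of the resolvent, the other bounds the mass of the
    occupancy of [p'] that weights the change of policy. *)
Lemma n1_occupancyB p p' : is_stochastic p -> is_stochastic p' ->
  n1 (occupancy P xi gamma p' - occupancy P xi gamma p)
    <= (1 - gamma)^-1 ^+ 2 * n1 (p' - p).
Proof.
move=> pst pst'; rewrite occupancy_performance_difference//.
have g0 : 0 <= (1 - gamma)^-1 by rewrite invr_ge0 subr_ge0 ltW.
apply: le_trans (n1_discounted _ pst) _.
rewrite mulrC expr2 -mulrA ler_wpM2l//.
apply: (@le_trans _ _ (\sum_s `|state_flow (occupancy P xi gamma p') s| *
    n1 (p' - p))).
  apply: ler_sum => s _; under eq_bigr do rewrite mxE normrM.
  rewrite -mulr_sumr ler_wpM2l// /n1 [leRHS](bigD1 s)//=.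
  have -> : \sum_a `|p' s a - p s a| = \sum_a `|(p' - p) s a|.
    by apply: eq_bigr => a _; rewrite !mxE.
  by rewrite lerDl; apply: sumr_ge0 => i _; apply: sumr_ge0.
rewrite -mulr_suml ler_wpM2r ?n1_ge0//.
exact: le_trans (sum_state_flow _) (n1_occupancy pst').
Qed.

End Discounted.

(** * Policy gradient *)

Section OperatorNorm.
Context {R : realType} {m n : nat}.
Implicit Type B : 'M[R]_(m, n).

Lemma mulmx_col_sum B (u : 'cV[R]_n) : B *m u = \sum_j u j 0 *: col j B.
Proof.
apply/matrixP => i k; rewrite mxE summxE; apply: eq_bigr => j _.
by rewrite !mxE (ord1 k) mulrC.
Qed.

(** [sup] dominates the members of a set only when the set is bounded above; any crude bound serves
    here. *)
Lemma opnorm_inf2_has_ubound B :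
  has_ubound [set n2 (B *m u) | u in [set u : 'cV[R]_n | ninf u <= 1]].
Proof.
exists (Num.sqrt (n%:R ^+ 2 * \sum_j sqn2 (col j B))) => _ [u /= u1 <-].
rewrite /n2 ler_wsqrtr// mulmx_col_sum.
apply: le_trans (sqn2_sum_le _ (D := \sum_j sqn2 (col j B)) _) _ => [j|].
  by rewrite (bigD1 j)//= lerDl sumr_ge0// => k _; exact: sqn2_ge0.
rewrite ler_wpM2r//.
  by apply: sumr_ge0 => j _; exact: sqn2_ge0.
rewrite ler_sqr ?nnegrE ?sumr_ge0//.
apply: (@le_trans _ _ (\sum_(j < n) 1)).
  by apply: ler_sum => j _; exact: le_trans (ninf_ge _ _ _) u1.
by rewrite sumr_const card_ord.
Qed.

Lemma opnorm_inf2_ge0 B : 0 <= opnorm_inf2 B.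
Proof.
apply: le_trans (sqrtr_ge0 (sqn2 (B *m 0))) _.
apply: ub_le_sup; first exact: opnorm_inf2_has_ubound.
by exists 0 => //=; apply: ninf_le => // i j; rewrite mxE normr0.
Qed.

Lemma sqn2_mulmx_le B (u : 'cV[R]_n) c : ninf u <= c ->
  sqn2 (B *m u) <= (opnorm_inf2 B * c) ^+ 2.
Proof.
move=> uc; have c0 : 0 <= c := le_trans (ninf_ge0 u) uc.
have [c00|cn0] := eqVneq c 0.
  have -> : u = 0.
    apply/matrixP => i j; rewrite mxE; apply/eqP; rewrite -normr_le0.
    by rewrite -c00 (le_trans (ninf_ge u i j)).
  by rewrite mulmx0 c00 mulr0 expr0n sqn2E linear0.
have cgt0 : 0 < c by rewrite lt_def cn0.
have -> : u = c *: (c^-1 *: u) by rewrite scalerA divff// scale1r.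
rewrite -scalemxAr sqn2Z mulrC exprMn ler_wpM2r ?sqr_ge0//.
rewrite -(sqr_sqrtr (sqn2_ge0 _)) ler_sqr ?nnegrE ?sqrtr_ge0 ?opnorm_inf2_ge0//.
apply: ub_le_sup; first exact: opnorm_inf2_has_ubound.
exists (c^-1 *: u) => //=; apply: ninf_le => // i j; rewrite mxE normrM.
rewrite ger0_norm ?invr_ge0// ler_pdivrMl// mulr1.
exact: le_trans (ninf_ge u i j) uc.
Qed.

End OperatorNorm.

(** * The bilinear policy-gradient functional and the policy gradient theorem *)

Section PolicyGradient.
Context {R : realType} {S A d : nat}.
Variables (P : 'I_A -> 'M[R]_S) (gamma : R) (pi : 'rV[R]_d -> 'M[R]_(S, A)).
Variable theta : 'rV[R]_d.
Hypothesis Pst : forall a, is_stochastic (P a).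
Hypotheses (gamma_gt0 : 0 < gamma) (gamma_lt1 : gamma < 1).
Hypothesis pi_st : is_stochastic (pi theta).
Implicit Types (mu nu z : 'M[R]_(S, A)).

Definition state_gradient z (s : 'I_S) : 'rV[R]_d :=
  \sum_a Qfun P gamma (pi theta) z s a *: gradv (fun th => pi th s a) theta.

(** Separating the occupancy [mu] from the reward [z] yields a bilinear map, so that the exact
    gradient and its estimate are the same map at different arguments. *)
Definition policy_op mu z : 'rV[R]_d :=
  \sum_s state_flow mu s *: state_gradient z s.

Lemma state_flow_linear c mu nu s :
  state_flow (c *: mu + nu) s = c * state_flow mu s + state_flow nu s.
Proof.
rewrite /state_flow mulr_sumr -big_split/=; apply: eq_bigr => a _.
by rewrite !mxE.
Qed.

Lemma policy_op_linear_l z : linear (policy_op^~ z).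
Proof.
move=> c mu nu; rewrite /policy_op scaler_sumr -big_split/=.
by apply: eq_bigr => s _; rewrite state_flow_linear scalerDl scalerA.
Qed.

Lemma policy_op_linear_r mu : linear (policy_op mu).
Proof.
move=> c z z'; rewrite /policy_op scaler_sumr -big_split/=.
apply: eq_bigr => s _; rewrite scalerA mulrC -scalerA -scalerDr; congr (_ *: _).
rewrite /state_gradient scaler_sumr -big_split/=; apply: eq_bigr => a _.
by rewrite !Qfun_discounted// linearP/= scalerDl scalerA.
Qed.

Lemma policy_op_delta s a z : policy_op (delta_mx s a) z = state_gradient z s.
Proof.
have flow s' : state_flow (delta_mx s a : 'M[R]_(S, A)) s' = (s' == s)%:R.
  rewrite /state_flow (bigD1 a)//= mxE eqxx andbT big1 ?addr0// => b /negPf ba.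
  by rewrite mxE ba andbF.
rewrite /policy_op (bigD1 s)//= flow eqxx scale1r big1 ?addr0// => s' /negPf ss.
by rewrite flow ss scale0r.
Qed.

Variable C : R.
Hypothesis gradC : forall s : 'I_S,
  opnorm_inf2 (\matrix_(i < d, a < A) gradv (fun th => pi th s a) theta 0 i) <= C.

(** At each state the contribution is the policy Jacobian applied to the column of Q-values, whose
    sup norm is at most [ninf z / (1 - gamma)]; the operator norm therefore brings no factor
    depending on [A]. The states are then combined by [sqn2_sum_le]. *)
Lemma sqn2_policy_op mu z :
  sqn2 (policy_op mu z) <= (n1 mu * (C * (ninf z / (1 - gamma)))) ^+ 2.
Proof.
have c0 : 0 <= ninf z / (1 - gamma).
  by rewrite divr_ge0 ?ninf_ge0// subr_ge0 ltW.
apply: (@le_trans _ _ ((\sum_s `|state_flow mu s|) ^+ 2 *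
    (C * (ninf z / (1 - gamma))) ^+ 2)); last first.
  rewrite [leRHS]exprMn ler_wpM2r ?sqr_ge0//.
  by rewrite ler_sqr ?nnegrE ?n1_ge0 ?sumr_ge0// sum_state_flow.
apply: sqn2_sum_le => s.
set B := \matrix_(i < d, a < A) gradv (fun th => pi th s a) theta 0 i.
pose u : 'cV[R]_A := \col_a Qfun P gamma (pi theta) z s a.
have -> : sqn2 (state_gradient z s) = sqn2 (B *m u).
  rewrite /sqn2 big_ord1; apply: eq_bigr => i _; rewrite big_ord1; congr (_ ^+ 2).
  rewrite summxE mxE; apply: eq_bigr => a _.
  by rewrite [in LHS]mxE [B _ _]mxE [u _ _]mxE mulrC.
have uc : ninf u <= ninf z / (1 - gamma).
  by apply: ninf_le => // a j; rewrite mxE Qfun_le.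
apply: le_trans (sqn2_mulmx_le B uc) _.
have B0 := opnorm_inf2_ge0 B; have BC : opnorm_inf2 B <= C := gradC s.
have C0 : 0 <= C := le_trans B0 BC.
rewrite ler_sqr ?nnegrE.
- by rewrite ler_wpM2r.
- by rewrite mulr_ge0.
- by rewrite mulr_ge0.
Qed.

Variables (xi : 'rV[R]_S) (Theta : set 'rV[R]_d).
Hypothesis xi_distr : is_distr xi.
Hypotheses (oTheta : open Theta) (thetaT : Theta theta).
Hypothesis Theta_st : forall th, Theta th -> is_stochastic (pi th).
Hypothesis dpi : forall s a, differentiable (fun t => pi t s a) theta.
Variables (F : 'M[R]_(S, A) -> R) (LF : R).
Hypothesis dF : forall l, differentiable F l.
Hypothesis cF : concave_fun F.
Hypothesis LF0 : 0 <= LF.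
Hypothesis sF : forall l l', ninf (gradm F l - gradm F l') <= LF * n1 (l - l').

Let lam th := occupancy P xi gamma (pi th).

(** The occupancy is never differentiated. The performance difference identity writes the linear
    part of the increment of [F] through difference quotients of the policy alone, weighted by the
    state flow at the perturbed parameter, and the tangent bounds make the remainder quadratic. *)
Lemma policy_gradient :
  gradv (fun th => F (lam th)) theta = policy_op (lam theta) (gradm F (lam theta)).
Proof.
apply/rowP => i; rewrite mxE summxE.
set e : 'rV[R]_d := delta_mx 0 i; set B := (1 - gamma)^-1.
have B0 : 0 <= B by rewrite invr_ge0 subr_ge0 ltW.
pose th (h : R) := h *: e + theta.
pose q s a (h : R) := h^-1 * (pi (th h) s a - pi theta s a).
have hq s a : q s a h @[h --> 0^'] --> 'D_e (fun t => pi t s a) theta.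
  exact: (diff_derivable (v := e) (dpi s a)).
have h0 : h @[h --> 0^'] --> (0 : R) by exact: nbhs_dnbhs.
have hv s a : pi (th h) s a - pi theta s a @[h --> 0^'] --> (0 : R).
  rewrite -[X in _ --> X](mul0r ('D_e (fun t => pi t s a) theta)).
  have -> : (fun h => pi (th h) s a - pi theta s a) = (fun h => h * q s a h).
    apply/funext => h; rewrite /q; have [->|hn0] := eqVneq h 0.
      by rewrite /th scale0r add0r subrr mul0r.
    by rewrite mulrA divff ?mul1r.
  exact: cvgM h0 (hq s a).
have hm : n1 (pi (th h) - pi theta) @[h --> 0^'] --> (0 : R).
  rewrite -[X in _ --> X](_ : \sum_(s < S) \sum_(a < A) `|0 : R| = 0).
    apply: cvg_fsum => s; apply: cvg_fsum => a; apply: cvg_norm.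
    by under eq_cvg do rewrite !mxE; exact: hv.
  by rewrite big1// => s _; rewrite big1// => a _; rewrite normr0.
have nTheta : \forall h \near 0^', Theta (th h).
  have : th h @[h --> 0^'] --> theta.
    rewrite -[X in _ --> X]add0r -(scale0r e).
    by apply: cvgD; [exact: cvgZr_tmp|exact: cvg_cst].
  by apply; exact: open_nbhs_nbhs.
have occB : \forall h \near 0^',
    n1 (lam (th h) - lam theta) <= B ^+ 2 * n1 (pi (th h) - pi theta).
  near=> h; apply: n1_occupancyB => //; apply: Theta_st; by near: h.
(* Continuity of the state flow is squeezed out of the Lipschitz bound [occB]. *)
have hrho s : state_flow (lam (th h)) s @[h --> 0^'] --> state_flow (lam theta) s.
  apply/subr_cvg0; apply: norm_cvg0.
  apply: (@squeeze_cvgr _ _ _ _ (fun=> 0)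
    (fun h => B ^+ 2 * n1 (pi (th h) - pi theta))).
  - near=> h; rewrite normr_ge0/=.
    apply: (@le_trans _ _ (n1 (lam (th h) - lam theta))); last first.
      by near: h; exact: occB.
    rewrite -sumrB /n1 (bigD1 s)//= -[leLHS]addr0 lerD//.
      by rewrite (le_trans (ler_norm_sum _ _ _))// ler_sum// => a _; rewrite !mxE.
    by apply: sumr_ge0 => j _; apply: sumr_ge0.
  - exact: cvg_cst.
  - by rewrite -[X in _ --> X](mulr0 (B ^+ 2)); exact: cvgMl_tmp.
set Q := Qfun P gamma (pi theta) (gradm F (lam theta)).
pose main h := \sum_s state_flow (lam (th h)) s * \sum_a Q s a * q s a h.
pose quot h := h^-1 *: (F (lam (th h)) - F (lam theta)).
have hmain : main h @[h --> 0^'] -->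
    \sum_s state_flow (lam theta) s *
      \sum_a Q s a * 'D_e (fun t => pi t s a) theta.
  apply: cvg_fsum => s; apply: cvgM; first exact: hrho.
  by apply: cvg_fsum => a; apply: cvgMl_tmp.
(* With [m] the l1 change of policy, the remainder is at most [LF * B ^+ 4 * m ^+ 2] divided by the
   absolute value of [h]. One factor [m] over that absolute value is a convergent sum of difference
   quotients; the other factor [m] tends to 0. *)
have hrem : quot h - main h @[h --> 0^'] --> (0 : R).
  apply: norm_cvg0.
  apply: (@squeeze_cvgr _ _ _ _ (fun=> 0)
    (fun h => LF * B ^+ 4 * (n1 (pi (th h) - pi theta) *
      \sum_s \sum_a `|q s a h|))).
  - near=> h; rewrite normr_ge0/=.
    have hn0 : h != 0 by near: h; exact: nbhs_dnbhs_neq.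
    have ph : is_stochastic (pi (th h)) by apply: Theta_st; near: h.
    (* Pairing the performance difference with the gradient of [F] turns the resolvent into
       Q-values. *)
    have -> : main h = h^-1 * dotm (gradm F (lam theta)) (lam (th h) - lam theta).
      rewrite dotmC occupancy_performance_difference// dotm_discounted//.
      rewrite mulr_sumr; apply: eq_bigr => s _; rewrite !mulr_sumr.
      by apply: eq_bigr => a _; rewrite mxE /q /Q /lam; ring.
    rewrite /quot -[X in X - _]/(h^-1 * _) -mulrBr normrM.
    have -> : \sum_s \sum_a `|q s a h| = `|h^-1| * n1 (pi (th h) - pi theta).
      rewrite mulr_sumr; apply: eq_bigr => s _; rewrite mulr_sumr.
      by apply: eq_bigr => a _; rewrite !mxE /q normrM.
    set m := n1 (pi (th h) - pi theta).
    have -> : LF * B ^+ 4 * (m * (`|h^-1| * m)) =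
        `|h^-1| * (LF * (B ^+ 2 * m) ^+ 2) by ring.
    rewrite ler_wpM2l//.
    have up := concave_le_tangent dF cF (lam theta) (lam (th h)).
    have low := smooth_ge_tangent dF cF sF (lam theta) (lam (th h) - lam theta).
    rewrite addrCA subrr addr0 in low.
    have := n1_occupancyB Pst gamma_gt0 gamma_lt1 xi_distr pi_st ph.
    rewrite -/(lam _) -/(lam _) -/B => occ.
    apply: (@le_trans _ _ (LF * n1 (lam (th h) - lam theta) ^+ 2)).
      by rewrite ler_norml; apply/andP; split; lra.
    rewrite ler_wpM2l//.
    by rewrite ler_sqr ?nnegrE ?mulr_ge0 ?n1_ge0 ?exprn_ge0.
  - exact: cvg_cst.
  - rewrite -[X in _ --> X](mulr0 (LF * B ^+ 4)); apply: cvgMl_tmp.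
    rewrite -[X in _ --> X](mul0r (\sum_s \sum_a
      `|'D_e (fun t => pi t s a) theta|)); apply: cvgM => //.
    by apply: cvg_fsum => s; apply: cvg_fsum => a; exact: cvg_norm.
apply: cvg_lim => //.
rewrite -[X in _ --> X]addr0 -[X in X @ _]/quot.
have -> : quot = (fun h => main h + (quot h - main h)).
  by apply/funext => h; rewrite addrC subrK.
apply: cvgD hrem.
rewrite [X in _ --> X](_ : _ = \sum_s state_flow (lam theta) s *
      \sum_a Q s a * 'D_e (fun t => pi t s a) theta)//.
apply: eq_bigr => s _; rewrite mxE summxE; congr (_ * _).
by apply: eq_bigr => a _; rewrite !mxE.
Unshelve. all: by end_near. Qed.

End PolicyGradient.

(** * Sampling *)

Section SampleMeans.
Context {R : realType} {T : finType} {n : nat}.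
Variable q : T -> R.
Hypothesis q_ge0 : forall t, 0 <= q t.
Hypothesis q_sum1 : \sum_t q t = 1.
Hypothesis n_gt0 : (0 < n)%N.
Implicit Types (w : {ffun 'I_n -> T}) (t : T).

Definition sample_mean {V : lmodType R} (X : T -> V) w : V :=
  \sum_i n%:R^-1 *: X (w i).

Lemma sample_mean_update {V : lmodType R} (X : T -> V) w i t :
  sample_mean X w - sample_mean X (update w i t) = n%:R^-1 *: (X (w i) - X t).
Proof.
rewrite /sample_mean (bigD1 i)//= [in X in _ - X](bigD1 i)//= ffunE eqxx.
rewrite [in X in _ - X](eq_bigr (fun j => n%:R^-1 *: X (w j))).
  by rewrite opprD addrACA subrr addr0 scalerBr.
by move=> j /negPf ji; rewrite ffunE ji.
Qed.

Lemma n1_sample_mean {m k} (X : T -> 'M[R]_(m, k)) B w :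
  (forall t, n1 (X t) <= B) -> n1 (sample_mean X w) <= B.
Proof.
move=> XB; have n0R : n%:R != 0 :> R by rewrite pnatr_eq0 -lt0n.
apply: le_trans (n1_sum _) _.
apply: (@le_trans _ _ (\sum_(i < n) n%:R^-1 * B)).
  apply: ler_sum => i _; rewrite n1Z ger0_norm ?invr_ge0 ?ler0n//.
  by rewrite ler_wpM2l ?invr_ge0 ?ler0n.
by rewrite sumr_const card_ord -[leLHS]mulr_natl mulrA divff// mul1r.
Qed.

Lemma mean_dotm_sample_mean {m k} (X : T -> 'M[R]_(m, k)) (z : 'M[R]_(m, k)) w :
  n%:R^-1 * \sum_i dotm z (X (w i)) = dotm z (sample_mean X w).
Proof.
by rewrite linear_sum/= mulr_sumr; apply: eq_bigr => i _; rewrite linearZ.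
Qed.

Lemma mean_dotm {m k} (X : T -> 'M[R]_(m, k)) (z : 'M[R]_(m, k)) :
  \sum_t q t * dotm z (X t) = dotm z (\sum_t q t *: X t).
Proof. by rewrite linear_sum/=; apply: eq_bigr => t _; rewrite linearZ. Qed.

(** The squared deviation is the generalization gap of the linear test function
    [dotm (sample_mean Y w - mu) (Y t)], which changes by at most [2 * D / n%:R] when one draw is
    replaced. *)
Lemma sample_mean_variance {m k} (Y : T -> 'M[R]_(m, k)) D :
  (forall t, sqn2 (Y t) <= D) ->
  \sum_w prod_weight q w * sqn2 (sample_mean Y w - \sum_t q t *: Y t)
    <= 2 * D / n%:R.
Proof.
move=> YD; pose mu := \sum_t q t *: Y t.
refine (le_trans _ (stability_generalization q_ge0 q_sum1
  (f := fun w t => dotm (sample_mean Y w - mu) (Y t)) n_gt0 _)).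
  rewrite le_eqVlt; apply/orP; left; apply/eqP; apply: eq_bigr => w _.
  by rewrite mean_dotm_sample_mean mean_dotm -linearB.
move=> i w t; rewrite -dotmBl opprB addrA subrK sample_mean_update dotmZl.
rewrite mulrC ler_wpM2r ?invr_ge0 ?ler0n// dotmBl -sqn2E.
have := ler_norm_dotm_sqn2 (Y t) (Y (w i)); rewrite ler_norml => /andP[+ _].
have := YD t; have := YD (w i); lra.
Qed.

Variables (m k : nat) (F : 'M[R]_(m, k) -> R) (LF : R).
Hypothesis dF : forall l, differentiable F l.
Hypothesis cF : concave_fun F.
Hypothesis LF0 : 0 <= LF.
Hypothesis sF : forall l l', ninf (gradm F l - gradm F l') <= LF * n1 (l - l').

(* By cocoercivity the error is controlled by the Bregman gap of F, whose mean
   is a generalization gap; the resulting bound is free of the dimensions. *)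
Lemma sample_mean_gradient_variance (X : T -> 'M[R]_(m, k)) B :
  (forall t, n1 (X t) <= B) ->
  \sum_w prod_weight q w *
      ninf (gradm F (sample_mean X w) - gradm F (\sum_t q t *: X t)) ^+ 2
    <= 8 * LF ^+ 2 * B ^+ 2 / n%:R.
Proof.
move=> XB; pose mu := \sum_t q t *: X t.
(* The generalization gap of [f] is the symmetrized Bregman divergence between [mu] and the sample
   mean: the gap used by [cocoercive] plus its mirror image, which is nonnegative by concavity. *)
pose f w t := dotm (gradm F mu - gradm F (sample_mean X w)) (X t).
apply: (@le_trans _ _ (4 * LF * \sum_w prod_weight q w *
    (n%:R^-1 * \sum_i f w (w i) - \sum_t q t * f w t))).
  rewrite mulr_sumr; apply: ler_sum => w _.
  rewrite [leRHS]mulrCA ler_wpM2l ?prod_weight_ge0//.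
  apply: le_trans (cocoercive dF cF LF0 sF _ _) _.
  rewrite mean_dotm_sample_mean mean_dotm -/mu ler_wpM2l ?mulr_ge0//.
  have := concave_le_tangent dF cF (sample_mean X w) mu.
  rewrite !linearB/= !dotmBl; lra.
(* Replacing one draw moves the mean by at most [2 * B / n%:R] in l1, hence its gradient by [LF]
   times that in sup norm; pairing with [X] contributes the last [B]. *)
have -> : 8 * LF ^+ 2 * B ^+ 2 / n%:R = 4 * LF * (LF * (2 * B / n%:R) * B).
  by ring.
rewrite ler_wpM2l ?mulr_ge0//.
apply: stability_generalization => // i w t.
rewrite /f -dotmBl opprB addrC addrA addrNK.
apply: le_trans (ler_norm _) _; rewrite dotmC.
apply: le_trans (ler_dotm _ _) _; rewrite mulrC.
apply: ler_pM => //; [exact: ninf_ge0|exact: n1_ge0|].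
apply: le_trans (sF _ _) _; rewrite ler_wpM2l//.
rewrite -opprB n1N sample_mean_update n1Z ger0_norm ?invr_ge0 ?ler0n//.
rewrite mulrC ler_wpM2r ?invr_ge0 ?ler0n//.
apply: le_trans (n1B _ _) _; have := XB t; have := XB (w i); lra.
Qed.

End SampleMeans.

(** * The law of an episode, its mean occupancy and the truncation error *)

Section Trajectories.
Context {R : realType} {S A K : nat}.
Variables (P : 'I_A -> 'M[R]_S) (xi : 'rV[R]_S) (gamma : R) (p : 'M[R]_(S, A)).
Hypothesis Pst : forall a, is_stochastic (P a).
Hypothesis xi_distr : is_distr xi.
Hypotheses (gamma_gt0 : 0 < gamma) (gamma_lt1 : gamma < 1).
Hypothesis p_st : is_stochastic p.

Let kappa (x y : 'I_S * 'I_A) : R := P x.2 x.1 y.1 * p y.1 y.2.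

Let kappa_sum1 x : \sum_y kappa x y = 1.
Proof.
rewrite -(pair_bigA _ (fun s a => P x.2 x.1 s * p s a))/=.
under eq_bigr do rewrite -mulr_sumr stochastic_sum1// mulr1.
exact: stochastic_sum1.
Qed.

Let pair_fun (mu : 'M[R]_(S, A)) (x : 'I_S * 'I_A) : R := mu x.1 x.2.

Let iter_chain_step mu t :
  iter t (chain_step kappa) (pair_fun mu) = pair_fun (sa_dist P p mu t).
Proof.
elim: t => //= t ->; apply/funext => y.
rewrite /chain_step /pair_fun /sa_dist/= mxE pair_bigA/=.
by apply: eq_bigr => x _; rewrite /kappa mulrA.
Qed.

Lemma traj_prob_marginal (k : 'I_K.+1) (f : 'I_S * 'I_A -> R) :
  \sum_(tau : traj S A K) traj_prob P xi p tau * f (tau k) =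
  \sum_x sa_dist P p (init_sa xi p) k x.1 x.2 * f x.
Proof.
have := chain_marginal kappa_sum1 (pair_fun (init_sa xi p)) k f.
rewrite iter_chain_step => <-; apply: eq_bigr => tau _; congr (_ * _).
by rewrite /traj_prob /chain_weight /pair_fun mxE.
Qed.

Lemma traj_prob_ge0 (tau : traj S A K) : 0 <= traj_prob P xi p tau.
Proof.
case: xi_distr => xi0 _; apply: mulr_ge0.
  by apply: mulr_ge0 => //; exact: stochastic_ge0.
by apply: prodr_ge0 => k _; apply: mulr_ge0; exact: stochastic_ge0.
Qed.

Lemma traj_prob_sum1 : \sum_(tau : traj S A K) traj_prob P xi p tau = 1.
Proof.
have := traj_prob_marginal ord0 (fun=> 1); under eq_bigr do rewrite mulr1.
move=> ->; under eq_bigr do rewrite mulr1; case: xi_distr => _ <-.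
rewrite -(pair_bigA _ (fun s a => init_sa xi p s a))/=; apply: eq_bigr => s _.
by under eq_bigr do rewrite mxE; rewrite -mulr_sumr stochastic_sum1// mulr1.
Qed.

Definition traj_occupancy (tau : traj S A K) : 'M[R]_(S, A) :=
  \sum_(k < K.+1) gamma ^+ k *: delta_mx (tau k).1 (tau k).2.

Lemma n1_traj_occupancy tau : n1 (traj_occupancy tau) <= (1 - gamma)^-1.
Proof.
apply: le_trans (n1_sum _) _; apply: le_trans (geometric_sum_le _ _ K.+1) => //.
apply: ler_sum => k _; rewrite n1Z n1_delta mulr1 ger0_norm//.
by rewrite exprn_ge0// ltW.
Qed.

(** An episode has indices 0 to [K], so its mean is the partial sum with [K.+1] terms, obtained from
    the time marginals by linearity. *)
Lemma traj_occupancy_mean :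
  \sum_tau traj_prob P xi p tau *: traj_occupancy tau =
  discounted_partial P gamma p (init_sa xi p) K.+1.
Proof.
apply/matrixP => s a; rewrite summxE discounted_partialE.
under eq_bigr do rewrite mxE summxE mulr_sumr.
rewrite exchange_big/=; apply: eq_bigr => k _.
under eq_bigr do rewrite mxE mulrCA.
rewrite -mulr_sumr; congr (_ * _).
rewrite (traj_prob_marginal k (fun x => delta_mx x.1 x.2 s a)).
rewrite (bigD1 (s, a))//= mxE !eqxx mulr1 big1 ?addr0// => -[s' a'] /=.
rewrite xpair_eqE negb_and mxE ![_ == s']eq_sym ![_ == a']eq_sym.
by move=> /orP[] /negPf ->; rewrite ?andbF mulr0.
Qed.

Lemma n1_occupancy_tail :
  n1 (discounted_partial P gamma p (init_sa xi p) K.+1 - occupancy P xi gamma p)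
    <= gamma ^+ K.+1 / (1 - gamma).
Proof.
rewrite [occupancy _ _ _ _](discounted_iter Pst gamma_gt0 gamma_lt1 _ K.+1 p_st).
rewrite opprD addNKr n1N n1Z ger0_norm ?exprn_ge0 ?(ltW gamma_gt0)//.
rewrite ler_wpM2l ?exprn_ge0 ?(ltW gamma_gt0)//.
apply: le_trans (n1_discounted Pst gamma_gt0 gamma_lt1 _ p_st) _.
rewrite ler_piMl ?invr_ge0 ?subr_ge0 ?(ltW gamma_lt1)//.
by rewrite -[leRHS](n1_init_sa xi_distr p_st) n1_sa_dist.
Qed.

End Trajectories.

(** * Maximizers of the estimator objective *)

Section ArgmaxLimit.
Context {R : realType} {S A d : nat}.
Variables (F : 'M[R]_(S, A) -> R) (LF lF : R).
Hypothesis dF : forall l, differentiable F l.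
Hypothesis cF : concave_fun F.
Hypothesis sF : forall l l', ninf (gradm F l - gradm F l') <= LF * n1 (l - l').
Variables (l : 'M[R]_(S, A)) (G : 'M[R]_(S, A) -> 'rV[R]_d).
Hypothesis grad_le : ninf (gradm F l) <= lF.
Hypothesis Glin : linear G.

Let Phi (delta : R) (x : 'rV[R]_d) : \bar R :=
  ereal_inf [set (- Fconj F z +
      (dotm l z + delta * dotm (G z) x - delta / 2 * sqn2 x)%:E)%E
    | z in [set z : 'M[R]_(S, A) | ninf z <= lF]].

Let g := G (gradm F l).

(** The adjoint of [G], which moves [x] into the argument of [F]. *)
Let adj (x : 'rV[R]_d) : 'M[R]_(S, A) :=
  \matrix_(s, a) dotm (G (delta_mx s a)) x.

Let dotm_adj x z : dotm (G z) x = dotm (adj x) z.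
Proof.
pose H := HB.pack_for {linear 'M[R]_(S, A) -> 'rV[R]_d} G
  (GRing.isLinear.Build R 'M[R]_(S, A) 'rV[R]_d *:%R G Glin).
have -> : G z = H z by [].
rewrite {1}(matrix_sum_delta z) linear_sum dotm_suml; apply: eq_bigr => s _.
rewrite linear_sum dotm_suml; apply: eq_bigr => a _.
by rewrite linearZ dotmZl/= mxE mulrC.
Qed.

Let Fconj_le z m : (Fconj F z <= (dotm m z - F m)%:E)%E.
Proof. by apply: ge_ereal_inf; exists (dotm m z - F m)%:E => //; exists m. Qed.

(* Fenchel duality, in two one-sided bounds: the infimum over the ball dominates
   F, and choosing z = gradm F l bounds it by the tangent of F at l. *)
Lemma est_obj_ge delta x :
  ((F (l + delta *: adj x) - delta / 2 * sqn2 x)%:E <= Phi delta x)%E.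
Proof.
apply: le_ereal_inf_tmp => _ [z zlF <-].
have : (- (dotm (l + delta *: adj x) z - F (l + delta *: adj x))%:E <= - Fconj F z)%E.
  by rewrite leeN2 Fconj_le.
move=> /(leeD2r (dotm l z + delta * dotm (G z) x - delta / 2 * sqn2 x)%:E).
apply: le_trans; rewrite -EFinN -EFinD lee_fin dotmDl dotmZl dotm_adj; lra.
Qed.

Lemma est_obj_le delta x :
  (Phi delta x <= (F l + delta * dotm g x - delta / 2 * sqn2 x)%:E)%E.
Proof.
apply: ge_ereal_inf; eexists; first by exists (gradm F l).
(* The tangent inequality says that [l] attains the infimum defining the conjugate at
   [gradm F l]. *)
have : (- Fconj F (gradm F l) <= - (dotm l (gradm F l) - F l)%:E)%E.
  rewrite leeN2; apply: le_ereal_inf_tmp => _ [m _ <-]; rewrite lee_fin.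
  have := concave_le_tangent dF cF l m.
  rewrite linearB/= !(dotmC (gradm F l)); lra.
move=> /(leeD2r (dotm l (gradm F l) + delta * dotm (G (gradm F l)) x
  - delta / 2 * sqn2 x)%:E) h; apply: le_trans h _.
rewrite -EFinN -EFinD lee_fin /g; lra.
Qed.

Let phi delta x := fine (Phi delta x).

(** The two Fenchel bounds are real, so [Phi] is finite and passing to [fine] loses nothing. *)
Let PhiE delta x : Phi delta x = (phi delta x)%:E.
Proof.
rewrite fineK// fin_numE; apply/andP; split; apply/eqP => E.
  by have := est_obj_ge delta x; rewrite E.
by have := est_obj_le delta x; rewrite E.
Qed.

(** A modulus of continuity for [phi delta]: for fixed [z] only the linear and quadratic terms
    depend on [x], and [lF] bounds [z] uniformly over the ball. *)
Let modulus (delta : R) (x y : 'rV[R]_d) : R :=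
  `|delta| * (lF * n1 (adj (y - x))) + `|delta / 2 * (sqn2 y - sqn2 x)|.

Let adjN x : adj (- x) = - adj x.
Proof. by apply/matrixP => s a; rewrite !mxE linearN. Qed.

Let adj0 : adj 0 = 0.
Proof. by apply/matrixP => s a; rewrite !mxE linear0. Qed.

Let modulusC delta x y : modulus delta x y = modulus delta y x.
Proof.
rewrite /modulus -[y - x]opprB adjN n1N -[sqn2 y - sqn2 x]opprB.
by rewrite [_ * - _]mulrN normrN.
Qed.

Let phi_le delta x y : phi delta y <= phi delta x + modulus delta x y.
Proof.
rewrite -lerBlDr -lee_fin EFinD EFinN -!PhiE.
apply: le_ereal_inf_tmp => _ [z zlF <-]; rewrite leeBlDr//.
apply: ge_ereal_inf; eexists; first by exists z.
rewrite -addeA leeD2l// -EFinD lee_fin.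
have h1 : delta * dotm (G z) (y - x) <= `|delta| * (lF * n1 (adj (y - x))).
  apply: le_trans (ler_norm _) _; rewrite normrM ler_wpM2l// dotm_adj.
  by apply: le_trans (ler_dotm _ _) _; rewrite mulrC ler_wpM2r ?n1_ge0.
have h2 : - (delta / 2 * (sqn2 y - sqn2 x)) <= `|delta / 2 * (sqn2 y - sqn2 x)|.
  by rewrite -normrN ler_norm.
move: h1; rewrite linearB/= /modulus; lra.
Qed.

Let phi_cvg delta (x : 'rV[R]_d) (H : set_system 'rV[R]_d) {FH : Filter H} :
  (forall i, (fun y : 'rV[R]_d => y 0 i) @ H --> x 0 i) ->
  phi delta y @[y --> H] --> phi delta x.
Proof.
move=> coord.
have entry_cvg j : (y - x) 0 j @[y --> H] --> (0 : R).
  rewrite -[X in _ --> X](subrr (x 0 j)).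
  have -> : (fun y : 'rV[R]_d => (y - x) 0 j) = (fun y => y 0 j - x 0 j).
    by apply/funext => y; rewrite !mxE.
  by apply: cvgB; [exact: coord|exact: cvg_cst].
have dotm_cvg c : dotm c (y - x) @[y --> H] --> (0 : R).
  rewrite -[X in _ --> X](_ : \sum_(i < 1) \sum_(j < d) c i j * 0 = 0).
    apply: cvg_fsum => i; apply: cvg_fsum => j; apply: cvgMl_tmp.
    by rewrite (ord1 i); exact: entry_cvg.
  by rewrite big1// => i _; rewrite big1// => j _; rewrite mulr0.
have adj_cvg : n1 (adj (y - x)) @[y --> H] --> (0 : R).
  rewrite -[X in _ --> X](_ : \sum_(s < S) \sum_(a < A) `|0 : R| = 0).
    apply: cvg_fsum => s; apply: cvg_fsum => a; apply: cvg_norm.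
    by under eq_cvg do rewrite mxE; exact: dotm_cvg.
  by rewrite big1// => s _; rewrite big1// => a _; rewrite normr0.
have modulus_cvg : modulus delta x y @[y --> H] --> (0 : R).
  rewrite -[X in _ --> X](_ : `|delta| * (lF * 0) +
    `|delta / 2 * (sqn2 x - sqn2 x)| = 0); last first.
    by rewrite subrr !mulr0 normr0 addr0.
  apply: cvgD; first by apply: cvgMl_tmp; exact: cvgMl_tmp.
  apply: cvg_norm; apply: cvgMl_tmp; apply: cvgB; last exact: cvg_cst.
  apply: cvg_fsum => i; apply: cvg_fsum => j; rewrite (ord1 i) expr2.
  under eq_cvg do rewrite expr2.
  by apply: cvgM; exact: coord.
apply: (@squeeze_cvgr _ _ _ _ (fun y => phi delta x - modulus delta x y)
  (fun y => phi delta x + modulus delta x y)).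
- near=> y; have := phi_le delta x y; have := phi_le delta y x.
  rewrite (modulusC delta y x); lra.
- by rewrite -[X in _ --> X]subr0; apply: cvgB => //; exact: cvg_cst.
- by rewrite -[X in _ --> X]addr0; apply: cvgD => //; exact: cvg_cst.
Unshelve. all: by end_near. Qed.

Let phi_continuous delta : continuous (phi delta).
Proof.
by move=> x; apply: (phi_cvg (FH := nbhs_filter x)) => i; exact: coord_continuous.
Qed.

(** Continuity gives a maximizer on a box around [g]. A point outside the box is at least as far
    from [g] as 0 is, so the tangent bound puts its value below [F l], which the value at 0
    reaches. *)
Lemma est_obj_argmax_exists (delta : R) : 0 < delta ->
  exists x, is_argmax (Phi delta) x.
Proof.
move=> d0; pose r := n2 g.
pose box := [set x : 'rV[R]_d | forall i,
  x ord0 i \in `[g 0 i - r, g 0 i + r]].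
have boxE x : box x <-> forall i, `|(x - g) 0 i| <= r.
  split=> h i; have := h i.
    rewrite in_itv/= !mxE ler_norml => /andP[? ?].
    by apply/andP; split; lra.
  rewrite !mxE ler_norml in_itv/= => /andP[? ?].
  by apply/andP; split; lra.
have box0 : box 0.
  by apply/boxE => i; rewrite sub0r mxE normrN ler_entry_n2.
have box_nonempty : box !=set0 by exists 0.
have cbox : compact box.
  apply: (@rV_compact _ _ (fun i => [set` `[g 0 i - r, g 0 i + r]])) => i.
  exact: segment_compact.
have cphi : {within box, continuous (phi delta)}.
  by apply: continuous_subspaceT; exact: phi_continuous.
have [c cbx cmax] := @EVT_max_rV R d (phi delta) box box_nonempty cbox cphi.
exists c => y; rewrite !PhiE lee_fin.
have [yb|nyb] := pselect (box y); first by apply: cmax; rewrite inE.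
apply: (@le_trans _ _ (phi delta 0)); last by apply: cmax; rewrite inE.
have ny : sqn2 g <= sqn2 (y - g).
  rewrite leNgt; apply/negP => h; apply: nyb; apply/boxE => i.
  by rewrite (le_trans (ler_entry_n2 _ _ _))// /r /n2 ler_wsqrtr// ltW.
have := est_obj_le delta y; have := est_obj_ge delta 0.
rewrite !PhiE !lee_fin.
rewrite adj0 scaler0 addr0 [sqn2 0]sqn2E linear0.
move: ny; rewrite sqn2B dotmC => ny.
have : 0 <= delta / 2 * (sqn2 y - 2 * dotm g y).
  by rewrite mulr_ge0//; lra.
lra.
Qed.

(** The value at the maximizer is compared with the value at [g]. After completing the square, the
    upper bound at [x] and the lower bound at [g] differ by [delta / 2 * sqn2 (x - g)] up to a
    smoothness error of order [delta ^+ 2]; dividing by [delta / 2] leaves a bound of order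
    [delta]. *)
Lemma est_obj_argmax_close (delta : R) x : 0 < delta -> is_argmax (Phi delta) x ->
  sqn2 (x - g) <= 2 * LF * delta * n1 (adj g) ^+ 2.
Proof.
move=> d0 /(_ g); rewrite !PhiE lee_fin => xg.
have := est_obj_le delta x; have := est_obj_ge delta g.
rewrite !PhiE !lee_fin => gl xu.
have := smooth_ge_tangent dF cF sF l (delta *: adj g).
rewrite n1Z gtr0_norm// linearZ/= dotmC -dotm_adj -/g -sqn2E.
rewrite sqn2B dotmC => low.
rewrite -(ler_pM2l (_ : 0 < delta / 2)); last by lra.
have e : (delta * n1 (adj g)) ^+ 2 = delta * (delta * n1 (adj g) ^+ 2) by ring.
rewrite e in low; lra.
Qed.

Lemma est_obj_limit_of_argmax : is_limit_of_argmax Phi g.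
Proof.
split=> [delta d0|eps eps0]; first exact: est_obj_argmax_exists.
(* The absolute value and the added 1 make [c] positive, so that it can be divided by, while it
   still dominates the constant of [est_obj_argmax_close]. *)
pose c := 2 * `|LF| * n1 (adj g) ^+ 2 + 1.
have c0 : 0 < c by rewrite ltr_pwDr// !mulr_ge0 ?n1_ge0.
exists (eps ^+ 2 / c); split; first by rewrite divr_gt0// exprn_gt0.
move=> delta x d0 deta /(est_obj_argmax_close d0) h.
rewrite -(sqr_sqrtr (sqn2_ge0 _)) -/(n2 _) in h.
rewrite -(ler_sqr (x := n2 _)) ?nnegrE ?sqrtr_ge0 ?(ltW eps0)//.
apply: le_trans h _; move: deta; rewrite ltr_pdivlMr// => /ltW; apply: le_trans.
rewrite /c mulrDr mulr1 -[leLHS]addr0 lerD ?(ltW d0)//.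
have := ler_norm LF => LFa.
have -> : 2 * LF * delta * n1 (adj g) ^+ 2 = delta * (2 * LF * n1 (adj g) ^+ 2).
  ring.
by rewrite ler_wpM2l ?(ltW d0)// ler_wpM2r ?exprn_ge0 ?n1_ge0// ler_wpM2l.
Qed.

End ArgmaxLimit.

(** * Mean squared error *)

Lemma linear_comb {R : realType} {V W : lmodType R} (f : V -> W)
    (I : finType) (c : I -> R) (X : I -> V) :
  linear f -> f (\sum_i c i *: X i) = \sum_i c i *: f (X i).
Proof.
move=> flin.
pose H := HB.pack_for {linear V -> W} f
  (GRing.isLinear.Build R V W *:%R f flin).
by rewrite -[f]/(H : V -> W) linear_sum; apply: eq_bigr => i _; rewrite linearZ.
Qed.

Section Estimator.
Context {R : realType} {S A d K n : nat}.
Variables (P : 'I_A -> 'M[R]_S) (xi : 'rV[R]_S) (gamma : R).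
Variables (pi : 'rV[R]_d -> 'M[R]_(S, A)) (theta : 'rV[R]_d).
Hypothesis Pst : forall a, is_stochastic (P a).
Hypothesis xi_distr : is_distr xi.
Hypotheses (gamma_gt0 : 0 < gamma) (gamma_lt1 : gamma < 1).
Hypothesis pi_st : is_stochastic (pi theta).
Variables (F : 'M[R]_(S, A) -> R) (lF LF C : R).
Hypothesis dF : forall l, differentiable F l.
Hypothesis cF : concave_fun F.
Hypothesis LF0 : 0 <= LF.
Hypothesis sF : forall l l', ninf (gradm F l - gradm F l') <= LF * n1 (l - l').
Hypothesis grad_le : forall l, n1 l <= 2 / (1 - gamma) -> ninf (gradm F l) <= lF.
Hypothesis gradC : forall s : 'I_S,
  opnorm_inf2 (\matrix_(i < d, a < A) gradv (fun th => pi th s a) theta 0 i) <= C.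
Hypothesis n_gt0 : (0 < n)%N.
Implicit Types (w : sample S A K n) (z mu : 'M[R]_(S, A)).

Let B := (1 - gamma)^-1.
Let B_ge0 : 0 <= B.
Proof. by rewrite invr_ge0 subr_ge0 ltW. Qed.

Let op := policy_op P gamma pi theta.
Let lam := occupancy P xi gamma (pi theta).
Let lamK := discounted_partial P gamma (pi theta) (init_sa xi (pi theta)) K.+1.
Let q := @traj_prob R S A K P xi (pi theta).

Definition empirical_occupancy w : 'M[R]_(S, A) :=
  sample_mean (traj_occupancy gamma) w.

Lemma n1_empirical_occupancy w : n1 (empirical_occupancy w) <= B.
Proof. by apply: n1_sample_mean => // t; exact: n1_traj_occupancy. Qed.

(** Both sample estimators are the exact functionals evaluated at the empirical occupancy, which
    makes [est_obj] an instance of the objective [Phi] studied above. *)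
Lemma Vtilde_empirical z w : Vtilde gamma z w = dotm (empirical_occupancy w) z.
Proof.
rewrite dotmC -mean_dotm_sample_mean /Vtilde; congr (_ * _).
apply: eq_bigr => i _; rewrite linear_sum/=; apply: eq_bigr => k _.
by rewrite linearZ/= dotmC dotm_delta.
Qed.

Lemma gradVtilde_empirical z w :
  gradVtilde P gamma pi theta z w = op (empirical_occupancy w) z.
Proof.
rewrite /op /empirical_occupancy /sample_mean.
rewrite (linear_comb _ _ (policy_op_linear_l _ _ _ _ z)) /gradVtilde scaler_sumr.
apply: eq_bigr => i _; congr (_ *: _).
rewrite /traj_occupancy (linear_comb _ _ (policy_op_linear_l _ _ _ _ z)).
apply: eq_bigr => k _; rewrite policy_op_delta /state_gradient scaler_sumr.
by apply: eq_bigr => a _; rewrite scalerA.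
Qed.

Let grad_le_B mu : n1 mu <= B -> ninf (gradm F mu) <= lF.
Proof.
by move=> muB; apply: grad_le; apply: le_trans muB _; rewrite ler_peMl// ler1n.
Qed.

Definition gradient_estimate w : 'rV[R]_d :=
  op (empirical_occupancy w) (gradm F (empirical_occupancy w)).

Lemma gradient_estimate_limit w :
  is_limit_of_argmax (est_obj P gamma pi theta F lF w) (gradient_estimate w).
Proof.
have -> : est_obj P gamma pi theta F lF w = (fun delta x =>
  ereal_inf [set (- Fconj F z + (dotm (empirical_occupancy w) z
      + delta * dotm (op (empirical_occupancy w) z) x - delta / 2 * sqn2 x)%:E)%E
    | z in [set z : 'M[R]_(S, A) | ninf z <= lF]]).
  apply/funext => delta; apply/funext => x; congr ereal_inf.
  by apply: eq_imagel => z _; rewrite Vtilde_empirical gradVtilde_empirical.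
apply: (est_obj_limit_of_argmax dF cF sF (G := op (empirical_occupancy w))).
  by apply: grad_le_B; exact: n1_empirical_occupancy.
exact: policy_op_linear_r.
Qed.

Let sqn2_op_le mu z b c : n1 mu <= b -> ninf z <= c ->
  sqn2 (op mu z) <= C ^+ 2 * B ^+ 2 * b ^+ 2 * c ^+ 2.
Proof.
move=> mub zc; apply: le_trans (sqn2_policy_op Pst gamma_gt0 gamma_lt1 pi_st
  gradC mu z) _.
have -> : (n1 mu * (C * (ninf z / (1 - gamma)))) ^+ 2 =
    C ^+ 2 * B ^+ 2 * (n1 mu ^+ 2 * ninf z ^+ 2) by rewrite /B; ring.
rewrite -[leRHS]mulrA ler_wpM2l//; first by rewrite -exprMn sqr_ge0.
have b0 := le_trans (n1_ge0 mu) mub; have c0 := le_trans (ninf_ge0 z) zc.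
by apply: ler_pM; rewrite ?sqr_ge0// ler_sqr ?nnegrE ?n1_ge0 ?ninf_ge0.
Qed.

(** The four errors are the fluctuation of the gradient of [F], its truncation bias, the fluctuation
    of the occupancy and its truncation bias. Passing through [lamK], the mean of the empirical
    occupancy, centres the fluctuations. *)
Let op_splitE w :
  gradient_estimate w - op lam (gradm F lam) =
  (op (empirical_occupancy w) (gradm F (empirical_occupancy w) - gradm F lamK) +
   op (empirical_occupancy w) (gradm F lamK - gradm F lam)) +
  (op (empirical_occupancy w - lamK) (gradm F lam) +
   op (lamK - lam) (gradm F lam)).
Proof.
have opBr mu z z' : op mu (z - z') = op mu z - op mu z'.
  by rewrite addrC -scaleN1r /op policy_op_linear_r// scaleN1r addrC.
have opBl mu mu' z : op (mu - mu') z = op mu z - op mu' z.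
  by rewrite addrC -scaleN1r /op policy_op_linear_l scaleN1r addrC.
have telescope (a b c e f : 'rV[R]_d) :
    a - f = (a - b + (b - c)) + ((c - e) + (e - f)).
  by apply/rowP => i; rewrite !mxE; ring.
rewrite !opBr !opBl; exact: telescope.
Qed.

Lemma gradient_estimate_mse :
  Esample P xi (pi theta)
    (fun w => sqn2 (gradient_estimate w - op lam (gradm F lam)))
  <= 32 * (C ^+ 2 * lF ^+ 2 * B ^+ 4 / n%:R + C ^+ 2 * LF ^+ 2 * B ^+ 6 / n%:R)
     + 4 * (C ^+ 2 * B ^+ 6 * LF ^+ 2 + C ^+ 2 * B ^+ 4 * lF ^+ 2) * gamma ^+ K.
Proof.
have q0 t : 0 <= q t by exact: traj_prob_ge0.
have q1 : \sum_t q t = 1 by exact: traj_prob_sum1.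
have mean : \sum_t q t *: traj_occupancy gamma t = lamK.
  exact: traj_occupancy_mean.
have lamB : n1 lam <= B by exact: n1_occupancy.
have tail : n1 (lamK - lam) <= gamma ^+ K.+1 * B by exact: n1_occupancy_tail.
have gK0 : 0 <= gamma ^+ K by rewrite exprn_ge0// ltW.
(* The truncation errors enter squared, and their rate is relaxed to [gamma ^+ K]. *)
have gK : (gamma ^+ K.+1) ^+ 2 <= gamma ^+ K.
  rewrite -exprM; apply: ler_wiXn2l; rewrite ?(ltW gamma_gt0) ?(ltW gamma_lt1)//.
  by rewrite muln2 -addnn leqW// leq_addr.
pose c := C ^+ 2 * B ^+ 4.
have c0 : 0 <= c by rewrite /c mulr_ge0 ?sqr_ge0 ?exprn_ge0.
have coef0 k x : 0 <= C ^+ 2 * B ^+ k * x ^+ 2.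
  by apply: mulr_ge0; [apply: mulr_ge0|]; rewrite ?sqr_ge0 ?exprn_ge0.
pose N w := ninf (gradm F (empirical_occupancy w) - gradm F lamK) ^+ 2.
pose V w := sqn2 (op (empirical_occupancy w - lamK) (gradm F lam)).
have T1 w : sqn2 (op (empirical_occupancy w)
    (gradm F (empirical_occupancy w) - gradm F lamK)) <= c * N w.
  apply: le_trans (sqn2_op_le (n1_empirical_occupancy w) (lexx _)) _.
  by rewrite le_eqVlt; apply/orP; left; apply/eqP; rewrite /c /N; ring.
have T2 w : sqn2 (op (empirical_occupancy w) (gradm F lamK - gradm F lam))
    <= C ^+ 2 * B ^+ 6 * LF ^+ 2 * gamma ^+ K.
  have h : ninf (gradm F lamK - gradm F lam) <= LF * (gamma ^+ K.+1 * B).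
    by apply: le_trans (sF _ _) _; rewrite ler_wpM2l.
  apply: le_trans (sqn2_op_le (n1_empirical_occupancy w) h) _.
  have -> : C ^+ 2 * B ^+ 2 * B ^+ 2 * (LF * (gamma ^+ K.+1 * B)) ^+ 2 =
    C ^+ 2 * B ^+ 6 * LF ^+ 2 * (gamma ^+ K.+1) ^+ 2 by ring.
  by rewrite ler_wpM2l// coef0.
have T4 : sqn2 (op (lamK - lam) (gradm F lam))
    <= C ^+ 2 * B ^+ 4 * lF ^+ 2 * gamma ^+ K.
  apply: le_trans (sqn2_op_le tail (grad_le_B lamB)) _.
  have -> : C ^+ 2 * B ^+ 2 * (gamma ^+ K.+1 * B) ^+ 2 * lF ^+ 2 =
    C ^+ 2 * B ^+ 4 * lF ^+ 2 * (gamma ^+ K.+1) ^+ 2 by ring.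
  by rewrite ler_wpM2l// coef0.
have EN : \sum_w prod_weight q w * N w <= 8 * LF ^+ 2 * B ^+ 2 / n%:R.
  rewrite /N -mean; apply: sample_mean_gradient_variance => // t.
  exact: n1_traj_occupancy.
have EV : \sum_w prod_weight q w * V w <= 2 * (c * lF ^+ 2) / n%:R.
  pose Y (t : traj S A K) : 'rV[R]_d := op (traj_occupancy gamma t) (gradm F lam).
  have opE w : op (empirical_occupancy w - lamK) (gradm F lam) =
      sample_mean Y w - \sum_t q t *: Y t.
    rewrite addrC -scaleN1r /op policy_op_linear_l scaleN1r addrC.
    congr (_ - _); first exact: (linear_comb _ _ (policy_op_linear_l _ _ _ _ _)).
    by rewrite -mean (linear_comb _ _ (policy_op_linear_l _ _ _ _ _)).
  rewrite /V; under eq_bigr do rewrite opE.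
  apply: sample_mean_variance => // t.
  have tB : n1 (traj_occupancy gamma t) <= B by exact: n1_traj_occupancy.
  apply: le_trans (sqn2_op_le tB (grad_le_B lamB)) _.
  by rewrite le_eqVlt; apply/orP; left; apply/eqP; rewrite /c; ring.
pose E2 := C ^+ 2 * B ^+ 6 * LF ^+ 2 * gamma ^+ K.
pose E4 := C ^+ 2 * B ^+ 4 * lF ^+ 2 * gamma ^+ K.
apply: (@le_trans _ _ (\sum_w (4 * c * (prod_weight q w * N w) +
    4 * (prod_weight q w * V w) + 4 * (E2 + E4) * prod_weight q w))).
  apply: ler_sum => w _.
  have -> : 4 * c * (prod_weight q w * N w) + 4 * (prod_weight q w * V w) +
      4 * (E2 + E4) * prod_weight q w =
      prod_weight q w * (4 * (c * N w + E2 + V w + E4)) by ring.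
  apply: ler_wpM2l; first exact: prod_weight_ge0.
  rewrite op_splitE; apply: le_trans (sqn2D4_le _ _ _ _) _.
  apply: ler_wpM2l => //; apply: lerD => //; apply: lerD => //.
  by apply: lerD; [exact: T1|exact: T2].
rewrite 2!big_split/= -!mulr_sumr prod_weight_sum1// mulr1.
move: (\sum_w prod_weight q w * N w) (\sum_w prod_weight q w * V w) EN EV.
move=> meanN meanV /(ler_wpM2l c0) EN EV.
(* Nonnegativity allows the coefficient [4 * 2] of the occupancy variance to be raised to 32. *)
have X0 : 0 <= C ^+ 2 * lF ^+ 2 * B ^+ 4 / n%:R.
  rewrite (_ : _ / _ = C ^+ 2 * B ^+ 4 * lF ^+ 2 / n%:R); last by ring.
  by rewrite divr_ge0.
have EN' : c * meanN <= 8 * (C ^+ 2 * LF ^+ 2 * B ^+ 6 / n%:R).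
  by apply: le_trans EN _; rewrite /c le_eqVlt; apply/orP; left; apply/eqP; ring.
have EV' : meanV <= 2 * (C ^+ 2 * lF ^+ 2 * B ^+ 4 / n%:R).
  by apply: le_trans EV _; rewrite /c le_eqVlt; apply/orP; left; apply/eqP; ring.
have -> : 4 * (C ^+ 2 * B ^+ 6 * LF ^+ 2 + C ^+ 2 * B ^+ 4 * lF ^+ 2) * gamma ^+ K =
  4 * (E2 + E4) by rewrite /E2 /E4; ring.
rewrite lerD2r -[4 * c * _]mulrA.
move: (c * meanN) (C ^+ 2 * lF ^+ 2 * B ^+ 4 / n%:R)
  (C ^+ 2 * LF ^+ 2 * B ^+ 6 / n%:R) EN' EV' X0.
move=> x y z; lra.
Qed.

End Estimator.

Theorem theorem2 :
  exists c0 : nat,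
  forall (R : realType) (S A d : nat)
    (P : 'I_A -> 'M[R]_S) (xi : 'rV[R]_S) (gamma : R)
    (Theta : set 'rV[R]_d) (pi : 'rV[R]_d -> 'M[R]_(S, A)) (theta : 'rV[R]_d)
    (F : 'M[R]_(S, A) -> R) (lF LF lFs C : R),
    (* finite MDP *)
    (forall a, is_stochastic (P a)) -> is_distr xi ->
    0 < gamma -> gamma < 1 ->
    (* parametric policies on Theta, theta fixed in Theta *)
    open Theta -> Theta theta ->
    (forall th, Theta th -> is_stochastic (pi th)) ->
    (* (i) *)
    concave_fun F ->
    (forall l, differentiable F l) ->
    (forall l, n1 l <= 2 / (1 - gamma) -> ninf (gradm F l) <= lF) ->
    (* (ii) *)
    (forall l l', ninf (gradm F l - gradm F l') <= LF * n1 (l - l')) ->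
    (* (iii) *)
    (forall z z', ninf z <= 2 * lF -> (-oo < Fconj F z)%E ->
                  ninf z' <= 2 * lF -> (-oo < Fconj F z')%E ->
       (`| Fconj F z - Fconj F z' | <= (lFs * ninf (z - z'))%:E)%E) ->
    (* (iv) *)
    (forall th s a, Theta th -> differentiable (fun t => pi t s a) th) ->
    (forall s : 'I_S,
       opnorm_inf2 (\matrix_(i < d, a < A) gradv (fun th => pi th s a) theta 0 i)
         <= C) ->
    exists C1 : R, forall n K : nat, (0 < n)%N ->
      exists ghat : sample S A K n -> 'rV[R]_d,
        (forall w, 0 < sample_prob P xi (pi theta) w ->
           is_limit_of_argmax (est_obj P gamma pi theta F lF w) (ghat w)) /\
        Esample P xi (pi theta)
          (fun w => sqn2 (ghat w
                          - gradv (fun th => F (occupancy P xi gamma (pi th))) theta))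
        <= c0%:R * (C ^+ 2 * (lF ^+ 2 + LF ^+ 2 * lFs ^+ 2)
                      / (n%:R * (1 - gamma) ^+ 4)
                    + C ^+ 2 * LF ^+ 2 / (n%:R * (1 - gamma) ^+ 6))
           + C1 * gamma ^+ K.
Proof.
(* The constant is [4 * 8]: the factor of the four-term split times that of
   [sample_mean_gradient_variance]. *)
exists 32%N => R S A d P xi gamma Theta pi theta F lF LF lFs C.
move=> Pst xi_distr g0 g1 oTheta thetaT Theta_st cF dF grad_le sF _ dpi gradC.
have pi_st : is_stochastic (pi theta) by exact: Theta_st.
(* Unit total mass of [xi] and of a policy row forces both index sets to be nonempty; smoothness
   between a basis matrix and 0, at l1 distance 1, then gives the sign. *)
have LF0 : 0 <= LF.
  case: S P xi pi F Pst xi_distr dF cF grad_le sF Theta_st pi_st dpi gradC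
    => [|S] P xi pi F Pst xi_distr dF cF grad_le sF Theta_st pi_st dpi gradC.
    by case: xi_distr => _ /eqP; rewrite big_ord0 eq_sym oner_eq0.
  case: A P pi F Pst dF cF grad_le sF Theta_st pi_st dpi gradC
    => [|A] P pi F Pst dF cF grad_le sF Theta_st pi_st dpi gradC.
    by case: (pi_st ord0) => _ /eqP; rewrite big_ord0 eq_sym oner_eq0.
  have := le_trans (ninf_ge0 _) (sF (delta_mx ord0 ord0) 0).
  by rewrite subr0 n1_delta mulr1.
(* The two summands are the truncation errors of the gradient of [F] and of the occupancy; they are
   fixed before [n] and [K]. *)
exists (4 * (C ^+ 2 * (1 - gamma)^-1 ^+ 6 * LF ^+ 2
  + C ^+ 2 * (1 - gamma)^-1 ^+ 4 * lF ^+ 2)) => n K n0.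
exists (gradient_estimate P gamma pi theta F); split=> [w _|].
  exact: gradient_estimate_limit.
rewrite (policy_gradient Pst g0 g1 pi_st xi_distr oTheta thetaT Theta_st _
  dF cF LF0 sF); last by move=> s a; exact: dpi.
apply: le_trans (gradient_estimate_mse (K := K) Pst xi_distr g0 g1 pi_st dF cF LF0 sF
  grad_le gradC n0) _.
rewrite lerD2r ler_wpM2l// lerD//.
  have -> : C ^+ 2 * lF ^+ 2 * (1 - gamma)^-1 ^+ 4 / n%:R =
      C ^+ 2 * lF ^+ 2 / (n%:R * (1 - gamma) ^+ 4).
    by rewrite invfM exprVn; ring.
  rewrite ler_wpM2r ?invr_ge0 ?mulr_ge0 ?exprn_ge0 ?subr_ge0 ?(ltW g1)//.
  by rewrite ler_wpM2l ?sqr_ge0// lerDl mulr_ge0 ?sqr_ge0.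
by rewrite invfM exprVn le_eqVlt; apply/orP; left; apply/eqP; ring.
Qed.
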